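(* The category $\mathsf{DiffAss2}$ of difference associative $2$-algebras and the category $\mathsf{2TermDiffA}_\infty$ of $2$-term difference $A_\infty$-algebras are equivalent.
   Context: All vector spaces are over a field $\mathbf{k}$ of characteristic $0$. **I. The category $\mathsf{DiffAss2}$.** *2-vector spaces.* A 2-vector space is a category $C=(C_1\rightrightarrows C_0)$ internal to vector spaces: the objects $C_0$ and morphisms $C_1$ form vector spaces, and the source and target maps $s,t:C_1\to C_0$, the identity-assigning map $i:C_0\to C_1$, $x\mapsto i_x$ (also written $1$ or $1_x$), and the composition $C_1\times_{C_0}C_1\to C_1$ are linear. Here $g\circ f$ means first $f$, then $g$. A linear functor $C\to C'$ is a pair $(F_0,F_1)$ of linear maps $F_0:C_0\to C_0'$, $F_1:C_1\to C_1'$ compatible with all the structure maps. A bilinear functor $\bullet:C\times C\to C$ is a functor that is bilinear on objects and on morphisms. A natural isomorphism is called linear (bilinear, trilinear) if its components depend linearly (bilinearly, trilinearly) on the objects. *Associative 2-algebras.* An associative $2$-algebra $(C,\bullet,\mathcal{A})$ is a 2-vector space $C$ with a bilinear functor $\bullet:C\times C\to C$ and a trilinear natural isomorphism $\mathcal{A}_{x,y,z}:(x\bullet y)\bullet z\to x\bullet(y\bullet z)$ such that for all objects $x,y,z,t$ $$(1_x\bullet\mathcal{A}_{y,z,t})\circ\mathcal{A}_{x,y\bullet z,t}\circ(\mathcal{A}_{x,y,z}\bullet 1_t)=\mathcal{A}_{x,y,z\bullet t}\circ\mathcal{A}_{x\bullet y,z,t}.$$ A homomorphism $(C,\bullet,\mathcal{A})\to(C',\bullet',\mathcal{A}')$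 is a triple $(F_0,F_1,F_2)$ with $(F_0,F_1)$ a linear functor and $F_2(x,y):F_0(x)\bullet' F_0(y)\to F_0(x\bullet y)$ a bilinear natural isomorphism such that for all objects $x,y,z$ $$F_2(x,y\bullet z)\circ(1_{F_0(x)}\bullet' F_2(y,z))\circ\mathcal{A}'_{F_0(x),F_0(y),F_0(z)}=F_1(\mathcal{A}_{x,y,z})\circ F_2(x\bullet y,z)\circ(F_2(x,y)\bullet' 1_{F_0(z)}).$$ *Difference associative 2-algebras (objects).* A difference operator on $(C,\bullet,\mathcal{A})$ is a linear functor $D=(D_0,D_1):C\to C$ with a bilinear natural isomorphism $$\mathcal{D}_{x,y}:D_0(x\bullet y)\to D_0(x)\bullet y+x\bullet D_0(y)+D_0(x)\bullet D_0(y)$$ such that for all objects $x,y,z$ the following two morphisms out of $D_0((x\bullet y)\bullet z)$ are equal: $$\big(\mathcal{A}_{D_0(x),y,z}+\mathcal{A}_{x,D_0(y),z}+\mathcal{A}_{D_0(x),D_0(y),z}+\mathcal{A}_{x,y,D_0(z)}+\mathcal{A}_{D_0(x),y,D_0(z)}+\mathcal{A}_{x,D_0(y),D_0(z)}+\mathcal{A}_{D_0(x),D_0(y),D_0(z)}\big)\circ\big(\mathcal{D}_{x,y}\bullet 1_z+1_{(x\bullet y)\bullet D_0(z)}+\mathcal{D}_{x,y}\bullet 1_{D_0(z)}\big)\circ\mathcal{D}_{x\bullet y,z}$$ and $$\big(1_{D_0(x)\bullet(y\bullet z)}+1_x\bullet\mathcal{D}_{y,z}+1_{D_0(x)}\bullet\mathcal{D}_{y,z}\big)\circ\mathcal{D}_{x,y\bullet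 z}\circ D_1(\mathcal{A}_{x,y,z}).$$ The tuple $((C,\bullet,\mathcal{A}),D,\mathcal{D})$, or $(C,D,\mathcal{D})$, is called a difference associative $2$-algebra. *Morphisms.* A homomorphism of difference associative $2$-algebras $(C,D,\mathcal{D})\to(C',D',\mathcal{D}')$ is a tuple $F=(F_0,F_1,F_2,F_3)$ where $(F_0,F_1,F_2)$ is a homomorphism of the underlying associative $2$-algebras and $F_3(x):D_0'(F_0(x))\to F_0(D_0(x))$ is a linear natural isomorphism such that for all objects $x,y$ $$F_1(\mathcal{D}_{x,y})\circ F_3(x\bullet y)\circ D_1'(F_2(x,y))=\big(F_2(D_0(x),y)+F_2(x,D_0(y))+F_2(D_0(x),D_0(y))\big)\circ\big(F_3(x)\bullet'1_{F_0(y)}+1_{F_0(x)}\bullet'F_3(y)+F_3(x)\bullet'F_3(y)\big)\circ\mathcal{D}'_{F_0(x),F_0(y)}.$$ *Composition and identities.* $(G\circ F)_0=G_0\circ F_0$, $(G\circ F)_1=G_1\circ F_1$, $(G\circ F)_2(x,y)=G_1(F_2(x,y))\circ G_2(F_0(x),F_0(y))$, $(G\circ F)_3(x)=G_1(F_3(x))\circ G_3(F_0(x))$. The identity homomorphism has the identity linear functor as underlying functor, and identity natural transformations as its second and third components. **II. The category $\mathsf{2TermDiffA}_\infty$.** *2-term $A_\infty$-algebras.* A $2$-term $A_\infty$-algebra $\mathfrak{a}=(A_1\xrightarrow{\delta}A_0,\odot,\mu)$ consists of a $2$-term complex $A_1\xrightarrow{\delta}A_0$ (a linear map of vector spaces),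 bilinear maps $\odot:A_i\times A_j\to A_{i+j}$ ($0\le i+j\le1$) and a trilinear map $\mu:A_0\times A_0\times A_0\to A_1$ such that for all $x,y,z,t\in A_0$, $h,k\in A_1$: (A1) $\delta(x\odot h)=x\odot\delta(h)$; (A2) $\delta(h\odot x)=\delta(h)\odot x$; (A3) $\delta(h)\odot k=h\odot\delta(k)$; (A4) $x\odot(y\odot z)-(x\odot y)\odot z=\delta(\mu(x,y,z))$; (A5) $x\odot(y\odot h)-(x\odot y)\odot h=\mu(x,y,\delta(h))$; (A6) $x\odot(h\odot y)-(x\odot h)\odot y=\mu(x,\delta(h),y)$; (A7) $h\odot(x\odot y)-(h\odot x)\odot y=\mu(\delta(h),x,y)$; (A8) $x\odot\mu(y,z,t)-\mu(x\odot y,z,t)+\mu(x,y\odot z,t)-\mu(x,y,z\odot t)+\mu(x,y,z)\odot t=0$. An $A_\infty$-homomorphism $\mathfrak{a}\to\mathfrak{a}'=(A_1'\xrightarrow{\delta'}A_0',\odot',\mu')$ is a triple $(\varphi_0,\varphi_1,\varphi_2)$ with linear maps $\varphi_0:A_0\to A_0'$, $\varphi_1:A_1\to A_1'$ satisfying $\varphi_0\circ\delta=\delta'\circ\varphi_1$ and a bilinear map $\varphi_2:A_0\times A_0\to A_1'$ such that for all $x,y,z\in A_0$, $h\in A_1$: $\varphi_0(x\odot y)-\varphi_0(x)\odot'\varphi_0(y)=\delta'(\varphi_2(x,y))$; $\varphi_1(x\odot h)-\varphi_0(x)\odot'\varphi_1(h)=\varphi_2(x,\delta(h))$; $\varphi_1(h\odot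 x)-\varphi_1(h)\odot'\varphi_0(x)=\varphi_2(\delta(h),x)$; $\varphi_1(\mu(x,y,z))-\mu'(\varphi_0(x),\varphi_0(y),\varphi_0(z))=\varphi_2(x,y\odot z)-\varphi_2(x\odot y,z)+\varphi_0(x)\odot'\varphi_2(y,z)-\varphi_2(x,y)\odot'\varphi_0(z)$. *2-term difference $A_\infty$-algebras (objects).* A difference operator on $\mathfrak{a}$ is a triple $\mathfrak{d}=(d_0,d_1,d_2)$ of linear maps $d_0:A_0\to A_0$, $d_1:A_1\to A_1$ with $d_0\circ\delta=\delta\circ d_1$ and a bilinear map $d_2:A_0\times A_0\to A_1$ such that for all $x,y,z\in A_0$, $h\in A_1$: (D1) $d_0(x)\odot y+x\odot d_0(y)+d_0(x)\odot d_0(y)-d_0(x\odot y)=\delta(d_2(x,y))$; (D2) $d_0(x)\odot h+x\odot d_1(h)+d_0(x)\odot d_1(h)-d_1(x\odot h)=d_2(x,\delta(h))$; (D3) $d_1(h)\odot x+h\odot d_0(x)+d_1(h)\odot d_0(x)-d_1(h\odot x)=d_2(\delta(h),x)$; (D4) $(x+d_0(x))\odot d_2(y,z)-d_2(x\odot y,z)+d_2(x,y\odot z)-d_2(x,y)\odot(z+d_0(z))=\mu(d_0(x),y,z)+\mu(x,d_0(y),z)+\mu(x,y,d_0(z))+\mu(d_0(x),d_0(y),z)+\mu(d_0(x),y,d_0(z))+\mu(x,d_0(y),d_0(z))+\mu(d_0(x),d_0(y),d_0(z))-d_1(\mu(x,y,z))$. The pair $(\mathfrak{a},\mathfrak{d})$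 is a $2$-term difference $A_\infty$-algebra. *Morphisms.* A difference $A_\infty$-homomorphism $(\mathfrak{a},\mathfrak{d})\to(\mathfrak{a}',\mathfrak{d}')$, with $\mathfrak{d}'=(d_0',d_1',d_2')$, is a quadruple $\varphi=(\varphi_0,\varphi_1,\varphi_2,\varphi_3)$ where $(\varphi_0,\varphi_1,\varphi_2):\mathfrak{a}\to\mathfrak{a}'$ is an $A_\infty$-homomorphism and $\varphi_3:A_0\to A_1'$ is a linear map such that for all $x,y\in A_0$, $h\in A_1$: $\varphi_0(d_0(x))-d_0'(\varphi_0(x))=\delta'(\varphi_3(x))$; $\varphi_1(d_1(h))-d_1'(\varphi_1(h))=\varphi_3(\delta(h))$; $\varphi_1(d_2(x,y))-d_2'(\varphi_0(x),\varphi_0(y))=\{\varphi_2(d_0(x),y)+\varphi_2(x,d_0(y))+\varphi_2(d_0(x),d_0(y))-\varphi_3(x\odot y)\}+\{\varphi_3(x)\odot'\varphi_0(y)+\varphi_0(x)\odot'\varphi_3(y)-d_1'(\varphi_2(x,y))\}$. *Composition and identities.* $(\psi\circ\varphi)_0=\psi_0\circ\varphi_0$, $(\psi\circ\varphi)_1=\psi_1\circ\varphi_1$, $(\psi\circ\varphi)_2(x,y)=\psi_2(\varphi_0(x),\varphi_0(y))+\psi_1(\varphi_2(x,y))$, $(\psi\circ\varphi)_3(x)=\psi_3(\varphi_0(x))+\psi_1(\varphi_3(x))$. The identity of $(\mathfrak{a},\mathfrak{d})$ is $(\mathrm{Id}_{A_0},\mathrm{Id}_{A_1},0,0)$.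
   Formalization: In the third condition on a difference A∞-homomorphism, the terms φ3(x)⊙'d0'(φ0(y)) + φ0(d0(x))⊙'φ3(y) are added on the right; without them these homomorphisms are not closed under the given composition, so 2TermDiffA∞ would not be a category. *)

(* Defs.v *)
From HB Require Import structures.
From mathcomp Require Import all_boot all_order all_algebra.
From mathcomp Require Import sesquilinear.
From Stdlib Require Import FunctionalExtensionality ProofIrrelevance.

Set Implicit Arguments.
Unset Strict Implicit.
Unset Printing Implicit Defensive.

Import GRing.Theory.
Local Open Scope ring_scope.

Record category := Category {
  obj :> Type;
  arr : obj -> obj -> Type;
  ident : forall x, arr x x;
  compose : forall x y z, arr y z -> arr x y -> arr x z;
  compose_assoc : forall x y z t (h : arr z t) (g : arr y z) (f : arr x y),
    compose h (compose g f) = compose (compose h g) f;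
  compose_idl : forall x y (f : arr x y), compose (ident y) f = f;
  compose_idr : forall x y (f : arr x y), compose f (ident x) = f }.

Record functor (C D : category) := Functor {
  fobj :> C -> D;
  farr : forall x y, arr x y -> arr (fobj x) (fobj y);
  farr_id : forall x, farr (ident x) = ident (fobj x);
  farr_comp : forall x y z (g : arr y z) (f : arr x y),
    farr (compose g f) = compose (farr g) (farr f) }.

Definition functor_id (C : category) : functor C C :=
  @Functor C C id (fun _ _ f => f) (fun _ => erefl) (fun _ _ _ _ _ => erefl).

Lemma functor_comp_id (C D E : category) (G : functor D E) (F : functor C D) x :
  farr G (farr F (ident x)) = ident (G (F x)).
Proof. by rewrite !farr_id. Qed.

Lemma functor_comp_comp (C D E : category) (G : functor D E) (F : functor C D)
    x y z (g : arr y z) (f : arr x y) :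
  farr G (farr F (compose g f)) =
  compose (farr G (farr F g)) (farr G (farr F f)).
Proof. by rewrite !farr_comp. Qed.

Definition functor_comp (C D E : category) (G : functor D E) (F : functor C D)
    : functor C E :=
  @Functor C E (fun x => G (F x)) (fun _ _ f => farr G (farr F f))
    (functor_comp_id G F) (functor_comp_comp G F).

Record nat_iso (C D : category) (F G : functor C D) := NatIso {
  ni_arr : forall x, arr (F x) (G x);
  ni_inv : forall x, arr (G x) (F x);
  ni_natural : forall x y (f : arr x y),
    compose (ni_arr y) (farr F f) = compose (farr G f) (ni_arr x);
  ni_invl : forall x, compose (ni_inv x) (ni_arr x) = ident (F x);
  ni_invr : forall x, compose (ni_arr x) (ni_inv x) = ident (G x) }.

Definition equivalent (C D : category) : Prop :=
  exists (F : functor C D) (G : functor D C),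
    inhabited (nat_iso (functor_comp G F) (functor_id C)) /\
    inhabited (nat_iso (functor_comp F G) (functor_id D)).

Section Multilinear.
Variable k : fieldType.

Definition trilinear_map (U V W T : lmodType k) (f : U -> V -> W -> T) : Prop :=
  [/\ forall y z, linear (fun x => f x y z),
      forall x z, linear (fun y => f x y z)
    & forall x y, linear (f x y)].

Definition bilinear_map (U V W : lmodType k) (f : U -> V -> W) : Prop :=
  (forall y, linear (fun x => f x y)) /\ (forall x, linear (f x)).

Lemma linear_ext (U V : lmodType k) (f g : {linear U -> V}) : f =1 g -> f = g.
Proof.
move=> /functional_extensionality fg.
case: f g fg => [f [[f1] [f2]]] [g [[g1] [g2]]] /= fg; case: g / fg g1 g2 => g1 g2.
by rewrite (proof_irrelevance _ f1 g1) (proof_irrelevance _ f2 g2).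
Qed.

Lemma bilinear_ext (U V W : lmodType k) (f g : {bilinear U -> V -> W}) :
  f =2 g -> f = g.
Proof.
move=> fg; have {}fg : (f : U -> V -> W) = g.
  by apply: functional_extensionality => x; apply: functional_extensionality.
case: f g fg => [f [[f1 f2 f3 f4]]] [g [[g1 g2 g3 g4]]] /= fg.
case: g / fg g1 g2 g3 g4 => g1 g2 g3 g4.
by rewrite (proof_irrelevance _ f1 g1) (proof_irrelevance _ f2 g2)
           (proof_irrelevance _ f3 g3) (proof_irrelevance _ f4 g4).
Qed.

Definition pack_linear (U V : lmodType k) (f : U -> V) (fL : linear f) :
  {linear U -> V} := HB.pack f (GRing.isLinear.Build k U V *:%R f fL).

Definition pack_bilinear (U V W : lmodType k) (f : U -> V -> W)
    (fB : bilinear_map f) : {bilinear U -> V -> W} :=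
  HB.pack f (bilinear_isBilinear.Build k U V W *:%R *:%R f (fB.1, fB.2)).

End Multilinear.

(* A decision procedure for identities in abelian groups: [zmod] proves an
   equality between sums of atoms, [zlin h] reduces a goal [a = b] to the group
   identity [a + d = b + c], for [h : c = d]. *)
Inductive zexp := ZVar of nat | ZZero | ZAdd of zexp & zexp | ZOpp of zexp.

Fixpoint zcoef (e : zexp) (i : nat) : int :=
  match e with
  | ZVar j => if j == i then 1 else 0
  | ZZero => 0
  | ZAdd a b => zcoef a i + zcoef b i
  | ZOpp a => - zcoef a i
  end.

Fixpoint zeval (V : zmodType) (env : seq V) (e : zexp) : V :=
  match e with
  | ZVar j => env`_j
  | ZZero => 0
  | ZAdd a b => zeval env a + zeval env b
  | ZOpp a => - zeval env a
  end.

Lemma zevalE (V : zmodType) (env : seq V) e :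
  zeval env e = \sum_(i < size env) env`_i *~ zcoef e i.
Proof.
elim: e => [j||a IHa b IHb|a IHa] /=.
- case: (ltnP j (size env)) => [lt_j|le_j].
    rewrite (bigD1 (Ordinal lt_j)) //= eqxx mulr1z big1 ?addr0 // => i ne_ij.
    by rewrite ifF ?mulr0z //; apply/negbTE; rewrite eq_sym.
  rewrite nth_default // big1 // => i _; rewrite ifF ?mulr0z //.
  by apply/negbTE; rewrite neq_ltn (leq_trans (ltn_ord i) le_j) orbT.
- by rewrite big1 // => i _; rewrite mulr0z.
- by rewrite IHa IHb -big_split; apply: eq_bigr => i _; rewrite mulrzDr.
- by rewrite IHa -sumrN; apply: eq_bigr => i _; rewrite mulrNz.
Qed.

Lemma zeval_eq (V : zmodType) (env : seq V) e1 e2 :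
  all (fun i => zcoef e1 i == zcoef e2 i) (iota 0 (size env)) ->
  zeval env e1 = zeval env e2.
Proof.
move=> /allP eq12; rewrite !zevalE; apply: eq_bigr => i _.
by have /eqP-> : zcoef e1 i == zcoef e2 i by apply: eq12; rewrite mem_iota ltn_ord.
Qed.

Lemma zlin_subproof (V : zmodType) (a b c d : V) :
  c = d -> a + d = b + c -> a = b.
Proof. by move=> ->; apply: addIr. Qed.

Ltac zindex eqtac t env :=
  lazymatch env with
  | ?a :: ?env' =>
    match constr:(Set) with
    | _ => let _ := match constr:(Set) with _ => eqtac t a end in constr:(0%N)
    | _ => let n := zindex eqtac t env' in constr:(n.+1)
    end
  end.
Ltac zsyntactic t a := constr_eq t a.
Ltac zconvertible t a := unify t a.
Ltac zatom_index t env :=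
  match constr:(Set) with
  | _ => zindex zsyntactic t env
  | _ => zindex zconvertible t env
  end.
Ltac zatom_add t env :=
  match constr:(Set) with
  | _ => let _ := zatom_index t env in env
  | _ => constr:(t :: env)
  end.
Ltac zatoms t env :=
  lazymatch t with
  | GRing.zero => env
  | GRing.add ?a ?b => let env' := zatoms a env in zatoms b env'
  | GRing.opp ?a => zatoms a env
  | _ => zatom_add t env
  end.
Ltac zreify t env :=
  lazymatch t with
  | GRing.zero => constr:(ZZero)
  | GRing.add ?a ?b =>
    let a' := zreify a env in let b' := zreify b env in constr:(ZAdd a' b')
  | GRing.opp ?a => let a' := zreify a env in constr:(ZOpp a')
  | _ => let n := zatom_index t env in constr:(ZVar n)
  end.
Ltac zmod :=
  lazymatch goal with
  | |- @eq ?V ?a ?b =>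
    let env0 := zatoms a (@nil V) in let env := zatoms b env0 in
    let e1 := zreify a env in let e2 := zreify b env in
    exact: (@zeval_eq _ env e1 e2 erefl)
  end.
Ltac zlin h := apply: (zlin_subproof h); zmod.

Record two_vect (k : fieldType) := TwoVect {
  Ob : lmodType k;
  Mor : lmodType k;
  src : {linear Mor -> Ob};
  tgt : {linear Mor -> Ob};
  idt : {linear Ob -> Mor};
  comp : forall g f : Mor, src g = tgt f -> Mor;
  src_idt : forall x, src (idt x) = x;
  tgt_idt : forall x, tgt (idt x) = x;
  src_comp : forall g f (e : src g = tgt f), src (comp e) = src f;
  tgt_comp : forall g f (e : src g = tgt f), tgt (comp e) = tgt g;
  comp_idl : forall f (e : src (idt (tgt f)) = tgt f), comp e = f;
  comp_idr : forall f (e : src f = tgt (idt (src f))), comp e = f;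
  comp_assoc : forall h g f (hg : src h = tgt g) (gf : src g = tgt f)
    (h_gf : src h = tgt (comp gf)) (hg_f : src (comp hg) = tgt f),
    comp h_gf = comp hg_f;
  comp_linear : forall (a : k) g f g' f' (e : src g = tgt f)
    (e' : src g' = tgt f') (e'' : src (a *: g + g') = tgt (a *: f + f')),
    comp e'' = a *: comp e + comp e' }.

Arguments comp {k t} g f _.
Arguments src {k t}.
Arguments tgt {k t}.
Arguments idt {k} t.

Record hom (k : fieldType) (C : two_vect k) (x y : Ob C) := Hom {
  hmor :> Mor C;
  hsrc : src hmor = x;
  htgt : tgt hmor = y }.

Section TwoVectTheory.
Variables (k : fieldType) (C : two_vect k).
Implicit Types x y z : Ob C.

Lemma hom_ext x y (f g : hom x y) : f = g :> Mor C -> f = g.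
Proof.
case: f g => [f s t] [g s' t'] /= fg; case: g / fg s' t' => s' t'.
by rewrite (proof_irrelevance _ s s') (proof_irrelevance _ t t').
Qed.

Definition hid x : hom x x := Hom (src_idt x) (tgt_idt x).

Section Hcomp.
Variables (x y z : Ob C) (g : hom y z) (f : hom x y).
Lemma hcomp_subproof : src (hmor g) = tgt (hmor f). Proof. by rewrite hsrc htgt. Qed.
Lemma src_hcomp : src (comp (hmor g) (hmor f) hcomp_subproof) = x.
Proof. by rewrite src_comp hsrc. Qed.
Lemma tgt_hcomp : tgt (comp (hmor g) (hmor f) hcomp_subproof) = z.
Proof. by rewrite tgt_comp htgt. Qed.
Definition hcomp : hom x z := Hom src_hcomp tgt_hcomp.
End Hcomp.

Section Hadd.
Variables (x y x' y' : Ob C) (f : hom x y) (g : hom x' y').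
Lemma src_hadd : src (hmor f + hmor g) = x + x'.
Proof. by rewrite linearD !hsrc. Qed.
Lemma tgt_hadd : tgt (hmor f + hmor g) = y + y'.
Proof. by rewrite linearD !htgt. Qed.
Definition hadd : hom (x + x') (y + y') := Hom src_hadd tgt_hadd.
End Hadd.

(* The same morphism, with its target rewritten along an equality of objects. *)
Definition hretarget x y y' (e : y = y') (f : hom x y) : hom x y' :=
  Hom (hsrc f) (etrans (htgt f) e).

Definition is_iso x y (f : hom x y) : Prop :=
  exists g : hom y x, hcomp g f = hid x /\ hcomp f g = hid y.

Lemma comp_eq (g f g' f' : Mor C) e e' :
  g = g' -> f = f' -> comp g f e = comp g' f' e'.
Proof.
move=> gg' ff'; case: _ / gg' e' => e'; case: _ / ff' e' => e'.
by rewrite (proof_irrelevance _ e e').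
Qed.

Lemma comp_add (g f : Mor C) e : comp g f e = g + f - idt C (tgt f).
Proof.
set u := idt C (tgt f).
have su : src u = tgt f by rewrite src_idt.
have tu : tgt u = tgt f by rewrite tgt_idt.
have e1 : src u = tgt u by rewrite su tu.
have e2 : src g = tgt u by rewrite tu.
have e3 : src (1 *: g + u) = tgt (1 *: u + f) by rewrite !linearD !linearZ /= e2 su.
have e4 : src (-1 *: u + (1 *: g + u)) = tgt (-1 *: u + (1 *: u + f)).
  by rewrite linearD [RHS]linearD e3 !linearZ /= e1.
have -> : comp g f e = comp _ _ e4.
  by apply: comp_eq; rewrite ?scaleN1r ?scale1r; zmod.
rewrite (comp_linear e1 e3) (comp_linear e2 su) comp_idl.
have e5 : src g = tgt (idt C (src g)) by rewrite tgt_idt.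
have -> : comp g u e2 = comp g (idt C (src g)) e5.
  by apply: comp_eq => //; rewrite /u e.
have e6 : src (idt C (tgt u)) = tgt u by rewrite src_idt.
have -> : comp u u e1 = comp (idt C (tgt u)) u e6.
  by apply: comp_eq => //; rewrite tu.
by rewrite comp_idr comp_idl scaleN1r scale1r; zmod.
Qed.

Lemma hcompE x y z (g : hom y z) (f : hom x y) :
  hcomp g f = hmor g + hmor f - idt C y :> Mor C.
Proof. by rewrite /= comp_add htgt. Qed.

Lemma hom_is_iso x y (f : hom x y) : is_iso f.
Proof.
have sg : src (idt C x + idt C y - hmor f) = y.
  by rewrite linearB linearD /= !src_idt hsrc; zmod.
have tg : tgt (idt C x + idt C y - hmor f) = x.
  by rewrite linearB linearD /= !tgt_idt htgt; zmod.
by exists (Hom sg tg); split; apply: hom_ext; rewrite hcompE /=; zmod.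
Qed.

End TwoVectTheory.

Arguments hid {k C} x.

Declare Scope hom_scope.
Delimit Scope hom_scope with hom.
Bind Scope hom_scope with hom.
Notation "g ∘ f" := (hcomp g f) (at level 45, right associativity) : hom_scope.
Notation "f ⊞ g" := (hadd f g) (at level 43, left associativity) : hom_scope.
Notation "'1h'" := (hid _) (at level 0) : hom_scope.
Local Open Scope hom_scope.

Record lin_functor (k : fieldType) (C C' : two_vect k) := LinFunctor {
  lf_ob :> {linear Ob C -> Ob C'};
  lf_mor : {linear Mor C -> Mor C'};
  lf_src : forall f, src (lf_mor f) = lf_ob (src f);
  lf_tgt : forall f, tgt (lf_mor f) = lf_ob (tgt f);
  lf_idt : forall x, lf_mor (idt C x) = idt C' (lf_ob x);
  lf_comp : forall g f (e : src g = tgt f) (e' : src (lf_mor g) = tgt (lf_mor f)),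
    lf_mor (comp g f e) = comp (lf_mor g) (lf_mor f) e' }.

Record bilin_functor (k : fieldType) (C : two_vect k) := BilinFunctor {
  bf_ob : {bilinear Ob C -> Ob C -> Ob C};
  bf_mor : {bilinear Mor C -> Mor C -> Mor C};
  bf_src : forall f g, src (bf_mor f g) = bf_ob (src f) (src g);
  bf_tgt : forall f g, tgt (bf_mor f g) = bf_ob (tgt f) (tgt g);
  bf_idt : forall x y, bf_mor (idt C x) (idt C y) = idt C (bf_ob x y);
  bf_comp : forall g f g' f' (e : src g = tgt f) (e' : src g' = tgt f')
    (e'' : src (bf_mor g g') = tgt (bf_mor f f')),
    bf_mor (comp g f e) (comp g' f' e') = comp (bf_mor g g') (bf_mor f f') e'' }.

Section LinFunctorTheory.
Variables (k : fieldType) (C C' C'' : two_vect k).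

Lemma lin_functor_ext (F G : lin_functor C C') :
  lf_ob F = lf_ob G -> lf_mor F = lf_mor G -> F = G.
Proof.
case: F G => [F0 F1 a b c d] [G0 G1 a' b' c' d'] /= e0 e1.
case: G0 / e0 a' b' c' => a' b' c'; case: G1 / e1 a' b' c' d' => a' b' c' d'.
by rewrite (proof_irrelevance _ a a') (proof_irrelevance _ b b')
           (proof_irrelevance _ c c') (proof_irrelevance _ d d').
Qed.

Section Hmap.
Variables (F : lin_functor C C') (x y : Ob C) (f : hom x y).
Lemma src_hmap : src (lf_mor F (hmor f)) = F x. Proof. by rewrite lf_src hsrc. Qed.
Lemma tgt_hmap : tgt (lf_mor F (hmor f)) = F y. Proof. by rewrite lf_tgt htgt. Qed.
Definition hmap : hom (F x) (F y) := Hom src_hmap tgt_hmap.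
End Hmap.

Definition lin_functor_id : lin_functor C C.
Proof.
refine (@LinFunctor k C C [the {linear _ -> _} of idfun]
  [the {linear _ -> _} of idfun] _ _ _ _) => // g f e e' /=.
exact: comp_eq.
Defined.

Lemma lf_comp_comp (G : lin_functor C' C'') (F : lin_functor C C') g f e e' :
  lf_mor G (lf_mor F (comp g f e)) =
  comp (lf_mor G (lf_mor F g)) (lf_mor G (lf_mor F f)) e'.
Proof.
have e1 : src (lf_mor F g) = tgt (lf_mor F f) by rewrite lf_src lf_tgt e.
by rewrite (lf_comp e e1); apply: lf_comp.
Qed.

Definition lin_functor_comp (G : lin_functor C' C'') (F : lin_functor C C') :
  lin_functor C C''.
Proof.
refine (@LinFunctor k C C'' [the {linear _ -> _} of G \o F]
  [the {linear _ -> _} of lf_mor G \o lf_mor F] _ _ _ _) => /=.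
- abstract (by move=> f; rewrite !lf_src).
- abstract (by move=> f; rewrite !lf_tgt).
- abstract (by move=> x; rewrite !lf_idt).
- exact: lf_comp_comp.
Defined.

End LinFunctorTheory.

Section Hbul.
Variables (k : fieldType) (C : two_vect k) (B : bilin_functor C).
Variables (x y x' y' : Ob C) (f : hom x y) (g : hom x' y').
Lemma src_hbul : src (bf_mor B (hmor f) (hmor g)) = bf_ob B x x'.
Proof. by rewrite bf_src !hsrc. Qed.
Lemma tgt_hbul : tgt (bf_mor B (hmor f) (hmor g)) = bf_ob B y y'.
Proof. by rewrite bf_tgt !htgt. Qed.
Definition hbul : hom (bf_ob B x x') (bf_ob B y y') := Hom src_hbul tgt_hbul.
End Hbul.

Record assoc2 (k : fieldType) := Assoc2 {
  as_vect :> two_vect k;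
  bul : bilin_functor as_vect;
  asc : forall x y z : Ob as_vect,
    hom (bf_ob bul (bf_ob bul x y) z) (bf_ob bul x (bf_ob bul y z));
  asc_trilinear : trilinear_map (fun x y z => hmor (asc x y z));
  asc_iso : forall x y z, is_iso (asc x y z);
  asc_natural : forall x x' y y' z z'
    (f : hom x x') (g : hom y y') (h : hom z z'),
    asc x' y' z' ∘ hbul bul (hbul bul f g) h =
    hbul bul f (hbul bul g h) ∘ asc x y z;
  asc_coherence : forall x y z t,
    hbul bul (hid x) (asc y z t) ∘ asc x (bf_ob bul y z) t ∘
      hbul bul (asc x y z) (hid t) =
    asc x y (bf_ob bul z t) ∘ asc (bf_ob bul x y) z t }.

Notation "x • y" := (bf_ob (bul _) x y) (at level 40, left associativity) :
  ring_scope.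
Notation "f ⊡ g" := (hbul (bul _) f g) (at level 40, left associativity) :
  hom_scope.

Record assoc2_hom (k : fieldType) (C C' : assoc2 k) := Assoc2Hom {
  ah_fun :> lin_functor C C';
  ah2 : forall x y : Ob C, hom (ah_fun x • ah_fun y) (ah_fun (x • y));
  ah2_bilinear : bilinear_map (fun x y => hmor (ah2 x y));
  ah2_iso : forall x y, is_iso (ah2 x y);
  ah2_natural : forall x x' y y' (f : hom x x') (g : hom y y'),
    ah2 x' y' ∘ (hmap ah_fun f ⊡ hmap ah_fun g) =
    hmap ah_fun (f ⊡ g) ∘ ah2 x y;
  ah2_coherence : forall x y z,
    ah2 x (y • z) ∘ (1h ⊡ ah2 y z) ∘ asc (ah_fun x) (ah_fun y) (ah_fun z) =
    hmap ah_fun (asc x y z) ∘ ah2 (x • y) z ∘ (ah2 x y ⊡ 1h) }.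

Lemma bul_expand (k : fieldType) (C : assoc2 k) (D : {linear Ob C -> Ob C})
    (x y z : Ob C) :
  (D x • y + x • D y + D x • D y) • z + x • y • D z
    + (D x • y + x • D y + D x • D y) • D z =
  D x • y • z + x • D y • z + D x • D y • z + x • y • D z
    + D x • y • D z + x • D y • D z + D x • D y • D z.
Proof. by rewrite !linearDl !addrA. Qed.

Record diff_op (k : fieldType) (C : assoc2 k) := DiffOp {
  do_fun :> lin_functor C C;
  do2 : forall x y : Ob C,
    hom (do_fun (x • y)) (do_fun x • y + x • do_fun y + do_fun x • do_fun y);
  do2_bilinear : bilinear_map (fun x y => hmor (do2 x y));
  do2_iso : forall x y, is_iso (do2 x y);
  do2_natural : forall x x' y y' (f : hom x x') (g : hom y y'),
    do2 x' y' ∘ hmap do_fun (f ⊡ g) =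
    (hmap do_fun f ⊡ g ⊞ f ⊡ hmap do_fun g ⊞ hmap do_fun f ⊡ hmap do_fun g)
      ∘ do2 x y;
  (* The targets of the two sides agree only up to bilinearity of [•], so that
     the sides are compared in [Mor C]. *)
  do2_coherence : forall x y z,
    (asc (do_fun x) y z ⊞ asc x (do_fun y) z ⊞ asc (do_fun x) (do_fun y) z
       ⊞ asc x y (do_fun z) ⊞ asc (do_fun x) y (do_fun z)
       ⊞ asc x (do_fun y) (do_fun z) ⊞ asc (do_fun x) (do_fun y) (do_fun z))
      ∘ hretarget (bul_expand do_fun x y z)
          (do2 x y ⊡ hid z ⊞ hid (x • y • do_fun z) ⊞ do2 x y ⊡ hid (do_fun z))
      ∘ do2 (x • y) z
    = (hid (do_fun x • (y • z)) ⊞ hid x ⊡ do2 y z ⊞ hid (do_fun x) ⊡ do2 y z)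
        ∘ do2 x (y • z) ∘ hmap do_fun (asc x y z) :> Mor C }.

Record diff2 (k : fieldType) := Diff2 {
  df_alg :> assoc2 k;
  df_op : diff_op df_alg }.

Record diff2_hom (k : fieldType) (C C' : diff2 k) := Diff2Hom {
  dh_hom :> assoc2_hom C C';
  dh3 : forall x : Ob C, hom (df_op C' (dh_hom x)) (dh_hom (df_op C x));
  dh3_linear : linear (fun x => hmor (dh3 x));
  dh3_iso : forall x, is_iso (dh3 x);
  dh3_natural : forall x x' (f : hom x x'),
    dh3 x' ∘ hmap (df_op C') (hmap dh_hom f) =
    hmap dh_hom (hmap (df_op C) f) ∘ dh3 x;
  (* The targets agree only up to additivity of the functor [dh_hom]. *)
  dh3_coherence : forall x y,
    hmap dh_hom (do2 (df_op C) x y) ∘ dh3 (x • y)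
      ∘ hmap (df_op C') (ah2 dh_hom x y)
    = (ah2 dh_hom (df_op C x) y ⊞ ah2 dh_hom x (df_op C y)
         ⊞ ah2 dh_hom (df_op C x) (df_op C y))
        ∘ (dh3 x ⊡ hid (dh_hom y) ⊞ hid (dh_hom x) ⊡ dh3 y ⊞ dh3 x ⊡ dh3 y)
        ∘ do2 (df_op C') (dh_hom x) (dh_hom y) :> Mor C' }.

Section HomEquations.
Variables (k : fieldType) (C C' : two_vect k).

Lemma hbul_comp (B : bilin_functor C) x y z x' y' z'
    (g : hom y z) (f : hom x y) (g' : hom y' z') (f' : hom x' y') :
  hbul B (g ∘ f) (g' ∘ f') = hbul B g g' ∘ hbul B f f'.
Proof. by apply: hom_ext; apply: bf_comp. Qed.

Lemma bf_morDl (B : bilin_functor C) f f' g :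
  bf_mor B (f + f') g = bf_mor B f g + bf_mor B f' g.
Proof. exact: linearDl. Qed.

Lemma bf_morNl (B : bilin_functor C) f g : bf_mor B (- f) g = - bf_mor B f g.
Proof. exact: linearNl. Qed.

Lemma bf_morDr (B : bilin_functor C) f g g' :
  bf_mor B f (g + g') = bf_mor B f g + bf_mor B f g'.
Proof. exact: linearDr. Qed.

Lemma bf_morNr (B : bilin_functor C) f g : bf_mor B f (- g) = - bf_mor B f g.
Proof. exact: linearNr. Qed.

Lemma lf_morD (F : lin_functor C C') f g :
  lf_mor F (f + g) = lf_mor F f + lf_mor F g.
Proof. exact: linearD. Qed.

Lemma lf_morN (F : lin_functor C C') f : lf_mor F (- f) = - lf_mor F f.
Proof. exact: linearN. Qed.

Lemma idtD (x y : Ob C) : idt C (x + y) = idt C x + idt C y.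
Proof. exact: linearD. Qed.

End HomEquations.

(* Composites are turned into sums by [hcompE], after which the axioms and the
   coherence conditions are identities in the abelian group [Mor C]. *)
Lemma hmor_eq (k : fieldType) (C : two_vect k) (x y : Ob C) (f g : hom x y) :
  f = g -> hmor f = hmor g.
Proof. by move=> ->. Qed.

#[local] Opaque hcomp.

Tactic Notation "hom_expand" :=
  rewrite /= ?hcompE /= ?hcompE /= ?hcompE /= ?idtD ?lf_morD ?lf_morN ?bf_morDl
    ?bf_morNl ?bf_morDr ?bf_morNr ?lf_morD ?lf_morN ?lf_idt ?bf_idt ?lf_idt.
Tactic Notation "hom_expand" "in" hyp(h) :=
  rewrite /= ?hcompE /= ?hcompE /= ?hcompE /= ?idtD ?lf_morD ?lf_morN ?bf_morDl
    ?bf_morNl ?bf_morDr ?bf_morNr ?lf_morD ?lf_morN ?lf_idt ?bf_idt ?lf_idt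
    in h.

Section Assoc2Cat.
Variable k : fieldType.

Lemma assoc2_hom_ext (C C' : assoc2 k) (F G : assoc2_hom C C') :
  lf_ob F = lf_ob G -> lf_mor F = lf_mor G ->
  (forall x y, hmor (ah2 F x y) = hmor (ah2 G x y)) -> F = G.
Proof.
move=> e0 e1 e2; have {e0 e1} := lin_functor_ext e0 e1.
case: F G e2 => [F F2 a b c d] [G G2 a' b' c' d'] /= e2 e.
case: G / e G2 a' b' c' d' e2 => G2 a' b' c' d' e2.
have {}e2 : F2 = G2.
  apply: functional_extensionality_dep => x.
  by apply: functional_extensionality_dep => y; apply: hom_ext.
case: G2 / e2 a' b' c' d' => a' b' c' d'.
by rewrite (proof_irrelevance _ a a') (proof_irrelevance _ b b')
           (proof_irrelevance _ c c') (proof_irrelevance _ d d').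
Qed.

Section Id.
Variable C : assoc2 k.
Let F := lin_functor_id C.
Let F2 (x y : Ob C) := hid (x • y) : hom (F x • F y) (F (x • y)).

Lemma ah2_id_bilinear : bilinear_map (fun x y => hmor (F2 x y)).
Proof.
split=> [y|x] a u v; rewrite /F2 /=.
  by rewrite linearPl (linearP (idt C)).
by rewrite linearPr (linearP (idt C)).
Qed.

Lemma ah2_id_iso x y : is_iso (F2 x y). Proof. exact: hom_is_iso. Qed.

Lemma ah2_id_natural x x' y y' (f : hom x x') (g : hom y y') :
  F2 x' y' ∘ (hmap F f ⊡ hmap F g) = hmap F (f ⊡ g) ∘ F2 x y.
Proof. by apply: hom_ext; hom_expand; zmod. Qed.

Lemma ah2_id_coherence x y z :
  F2 x (y • z) ∘ (1h ⊡ F2 y z) ∘ asc (F x) (F y) (F z) =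
  hmap F (asc x y z) ∘ F2 (x • y) z ∘ (F2 x y ⊡ 1h).
Proof. by apply: hom_ext; hom_expand; zmod. Qed.

Definition assoc2_id : assoc2_hom C C :=
  Assoc2Hom ah2_id_bilinear ah2_id_iso ah2_id_natural ah2_id_coherence.

End Id.

Section Comp.
Variables (C C' C'' : assoc2 k) (G : assoc2_hom C' C'') (F : assoc2_hom C C').
Let GF := lin_functor_comp G F.

Definition ah2_comp (x y : Ob C) : hom (GF x • GF y) (GF (x • y)) :=
  hmap G (ah2 F x y) ∘ ah2 G (F x) (F y).

Lemma ah2_compE x y :
  ah2_comp x y =
  lf_mor G (hmor (ah2 F x y)) + hmor (ah2 G (F x) (F y)) - idt C'' (G (F x • F y))
  :> Mor C''.
Proof. exact: hcompE. Qed.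

Lemma ah2_comp_bilinear : bilinear_map (fun x y => hmor (ah2_comp x y)).
Proof.
have [Fl Fr] := ah2_bilinear F; have [Gl Gr] := ah2_bilinear G.
split=> [y|x] a u v; rewrite !ah2_compE.
  rewrite Fl (linearP (lf_mor G)) (linearP F) Gl linearPl (linearP G).
  by rewrite (linearP (idt C'')) !scalerDr scalerN; zmod.
rewrite Fr (linearP (lf_mor G)) (linearP F) Gr linearPr (linearP G).
by rewrite (linearP (idt C'')) !scalerDr scalerN; zmod.
Qed.

Lemma ah2_comp_iso x y : is_iso (ah2_comp x y).
Proof. exact: hom_is_iso. Qed.

Lemma ah2_comp_natural x x' y y' (f : hom x x') (g : hom y y') :
  ah2_comp x' y' ∘ (hmap GF f ⊡ hmap GF g) = hmap GF (f ⊡ g) ∘ ah2_comp x y.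
Proof.
apply: hom_ext.
have hF := congr1 (lf_mor G) (hmor_eq (ah2_natural F f g)).
have hG := hmor_eq (ah2_natural G (hmap F f) (hmap F g)).
hom_expand in hF; hom_expand in hG; hom_expand.
zlin (congr2 +%R hF hG).
Qed.

Lemma ah2_comp_coherence x y z :
  ah2_comp x (y • z) ∘ (1h ⊡ ah2_comp y z) ∘ asc (GF x) (GF y) (GF z) =
  hmap GF (asc x y z) ∘ ah2_comp (x • y) z ∘ (ah2_comp x y ⊡ 1h).
Proof.
apply: hom_ext.
have hF := congr1 (lf_mor G) (hmor_eq (ah2_coherence F x y z)).
have hG := hmor_eq (ah2_coherence G (F x) (F y) (F z)).
have n1 := hmor_eq (ah2_natural G (hid (F x)) (ah2 F y z)).
have n2 := hmor_eq (ah2_natural G (ah2 F x y) (hid (F z))).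
hom_expand in hF; hom_expand in hG; hom_expand in n1; hom_expand in n2; hom_expand.
zlin (congr2 +%R (congr2 +%R hF hG) (congr2 +%R n1 (esym n2))).
Qed.

Definition assoc2_comp : assoc2_hom C C'' :=
  Assoc2Hom ah2_comp_bilinear ah2_comp_iso ah2_comp_natural ah2_comp_coherence.

End Comp.
End Assoc2Cat.

Section Diff2Cat.
Variable k : fieldType.

Lemma diff2_hom_ext (C C' : diff2 k) (F G : diff2_hom C C') :
  lf_ob F = lf_ob G -> lf_mor F = lf_mor G ->
  (forall x y, hmor (ah2 F x y) = hmor (ah2 G x y)) ->
  (forall x, hmor (dh3 F x) = hmor (dh3 G x)) -> F = G.
Proof.
move=> e0 e1 e2 e3; have {e0 e1 e2} := assoc2_hom_ext e0 e1 e2.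
case: F G e3 => [F F3 a b c d] [G G3 a' b' c' d'] /= e3 e.
case: G / e G3 a' b' c' d' e3 => G3 a' b' c' d' e3.
have {}e3 : F3 = G3.
  by apply: functional_extensionality_dep => x; apply: hom_ext.
case: G3 / e3 a' b' c' d' => a' b' c' d'.
by rewrite (proof_irrelevance _ a a') (proof_irrelevance _ b b')
           (proof_irrelevance _ c c') (proof_irrelevance _ d d').
Qed.

Section Id.
Variable C : diff2 k.
Let F := assoc2_id C.
Let D := df_op C.
Let F3 (x : Ob C) := hid (D x) : hom (D (F x)) (F (D x)).

Lemma dh3_id_linear : linear (fun x => hmor (F3 x)).
Proof. by move=> a u v; rewrite /F3 /= (linearP D) (linearP (idt C)). Qed.

Lemma dh3_id_iso x : is_iso (F3 x). Proof. exact: hom_is_iso. Qed.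

Lemma dh3_id_natural x x' (f : hom x x') :
  F3 x' ∘ hmap D (hmap F f) = hmap F (hmap D f) ∘ F3 x.
Proof. by apply: hom_ext; hom_expand; zmod. Qed.

Lemma dh3_id_coherence x y :
  hmap F (do2 D x y) ∘ F3 (x • y) ∘ hmap D (ah2 F x y)
  = (ah2 F (D x) y ⊞ ah2 F x (D y) ⊞ ah2 F (D x) (D y))
      ∘ (F3 x ⊡ hid (F y) ⊞ hid (F x) ⊡ F3 y ⊞ F3 x ⊡ F3 y)
      ∘ do2 D (F x) (F y) :> Mor C.
Proof. by hom_expand; zmod. Qed.

Definition diff2_id : diff2_hom C C :=
  Diff2Hom dh3_id_linear dh3_id_iso dh3_id_natural dh3_id_coherence.

End Id.

Section Comp.
Variables (C C' C'' : diff2 k) (G : diff2_hom C' C'') (F : diff2_hom C C').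
Let GF := assoc2_comp G F.
Let D := df_op C.
Let D' := df_op C'.
Let D'' := df_op C''.

Definition dh3_comp (x : Ob C) : hom (D'' (GF x)) (GF (D x)) :=
  hmap G (dh3 F x) ∘ dh3 G (F x).

Lemma dh3_compE x :
  dh3_comp x =
  lf_mor G (hmor (dh3 F x)) + hmor (dh3 G (F x)) - idt C'' (G (D' (F x))) :> Mor C''.
Proof. exact: hcompE. Qed.

Lemma dh3_comp_linear : linear (fun x => hmor (dh3_comp x)).
Proof.
move=> a u v; rewrite !dh3_compE (dh3_linear F) (linearP (lf_mor G)) (linearP F).
rewrite (dh3_linear G) (linearP D') (linearP G) (linearP (idt C'')).
by rewrite !scalerDr scalerN; zmod.
Qed.

Lemma dh3_comp_iso x : is_iso (dh3_comp x). Proof. exact: hom_is_iso. Qed.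

Lemma dh3_comp_natural x x' (f : hom x x') :
  dh3_comp x' ∘ hmap D'' (hmap GF f) = hmap GF (hmap D f) ∘ dh3_comp x.
Proof.
apply: hom_ext.
have hF := congr1 (lf_mor G) (hmor_eq (dh3_natural F f)).
have hG := hmor_eq (dh3_natural G (hmap F f)).
hom_expand in hF; hom_expand in hG; hom_expand.
zlin (congr2 +%R hF hG).
Qed.

Lemma dh3_comp_coherence x y :
  hmap GF (do2 D x y) ∘ dh3_comp (x • y) ∘ hmap D'' (ah2 GF x y)
  = (ah2 GF (D x) y ⊞ ah2 GF x (D y) ⊞ ah2 GF (D x) (D y))
      ∘ (dh3_comp x ⊡ hid (GF y) ⊞ hid (GF x) ⊡ dh3_comp y
           ⊞ dh3_comp x ⊡ dh3_comp y)
      ∘ do2 D'' (GF x) (GF y) :> Mor C''.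
Proof.
have hF := congr1 (lf_mor G) (dh3_coherence F x y).
have hG := dh3_coherence G (F x) (F y).
have n1 := hmor_eq (ah2_natural G (dh3 F x) (hid (F y))).
have n2 := hmor_eq (ah2_natural G (hid (F x)) (dh3 F y)).
have n3 := hmor_eq (ah2_natural G (dh3 F x) (dh3 F y)).
have n4 := hmor_eq (dh3_natural G (ah2 F x y)).
have n5 := hmor_eq (hbul_comp (bul C'') (hmap G (dh3 F x)) (dh3 G (F x))
  (hmap G (dh3 F y)) (dh3 G (F y))).
hom_expand in hF; hom_expand in hG; hom_expand in n1; hom_expand in n2.
hom_expand in n3; hom_expand in n4; hom_expand in n5.
hom_expand.
zlin (congr2 +%R (congr2 +%R (congr2 +%R hF hG) n4)
        (esym (congr2 +%R (congr2 +%R n1 n2) (congr2 +%R n3 n5)))).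
Qed.

Definition diff2_comp : diff2_hom C C'' :=
  Diff2Hom dh3_comp_linear dh3_comp_iso dh3_comp_natural dh3_comp_coherence.

End Comp.

Lemma diff2_compA (C1 C2 C3 C4 : diff2 k) (H : diff2_hom C3 C4)
    (G : diff2_hom C2 C3) (F : diff2_hom C1 C2) :
  diff2_comp H (diff2_comp G F) = diff2_comp (diff2_comp H G) F.
Proof.
apply: diff2_hom_ext => [||x y|x]; [exact: linear_ext|exact: linear_ext| |].
- by hom_expand; zmod.
- by hom_expand; zmod.
Qed.

Lemma diff2_comp1l (C C' : diff2 k) (F : diff2_hom C C') :
  diff2_comp (diff2_id C') F = F.
Proof.
apply: diff2_hom_ext => [||x y|x]; [exact: linear_ext|exact: linear_ext| |].
- by hom_expand; zmod.
- by hom_expand; zmod.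
Qed.

Lemma diff2_comp1r (C C' : diff2 k) (F : diff2_hom C C') :
  diff2_comp F (diff2_id C) = F.
Proof.
apply: diff2_hom_ext => [||x y|x]; [exact: linear_ext|exact: linear_ext| |].
- by hom_expand; zmod.
- by hom_expand; zmod.
Qed.

Definition DiffAss2 : category :=
  Category diff2_compA diff2_comp1l diff2_comp1r.

End Diff2Cat.

#[local] Transparent hcomp.

(* [ai00], [ai01] and [ai10] are the components of the product, indexed by the
   degrees of the two factors. *)
Record ainf (k : fieldType) := Ainf {
  A0 : lmodType k;
  A1 : lmodType k;
  delta : {linear A1 -> A0};
  ai00 : {bilinear A0 -> A0 -> A0};
  ai01 : {bilinear A0 -> A1 -> A1};
  ai10 : {bilinear A1 -> A0 -> A1};
  mu : A0 -> A0 -> A0 -> A1;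
  mu_trilinear : trilinear_map mu;
  ai_A1 : forall x h, delta (ai01 x h) = ai00 x (delta h);
  ai_A2 : forall h x, delta (ai10 h x) = ai00 (delta h) x;
  ai_A3 : forall h l, ai01 (delta h) l = ai10 h (delta l);
  ai_A4 : forall x y z, ai00 x (ai00 y z) - ai00 (ai00 x y) z = delta (mu x y z);
  ai_A5 : forall x y h, ai01 x (ai01 y h) - ai01 (ai00 x y) h = mu x y (delta h);
  ai_A6 : forall x h y, ai01 x (ai10 h y) - ai10 (ai01 x h) y = mu x (delta h) y;
  ai_A7 : forall h x y, ai10 h (ai00 x y) - ai10 (ai10 h x) y = mu (delta h) x y;
  ai_A8 : forall x y z t,
    ai01 x (mu y z t) - mu (ai00 x y) z t + mu x (ai00 y z) t
      - mu x y (ai00 z t) + ai10 (mu x y z) t = 0 }.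

Arguments delta {k a}.
Arguments mu {k a} _ _ _.

Declare Scope ainf_scope.
Delimit Scope ainf_scope with ainf.
Notation "x ⊙ y" := (ai00 _ x y) (at level 40, left associativity) : ainf_scope.
Notation "x ⊙r h" := (ai01 _ x h) (at level 40, left associativity) : ainf_scope.
Notation "h ⊙l x" := (ai10 _ h x) (at level 40, left associativity) : ainf_scope.
Local Open Scope ainf_scope.

Record ainf_hom (k : fieldType) (a a' : ainf k) := AinfHom {
  phi0 :> {linear A0 a -> A0 a'};
  phi1 : {linear A1 a -> A1 a'};
  phi2 : {bilinear A0 a -> A0 a -> A1 a'};
  phi_delta : forall h, phi0 (delta h) = delta (phi1 h);
  phi2_00 : forall x y, phi0 (x ⊙ y) - phi0 x ⊙ phi0 y = delta (phi2 x y);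
  phi2_01 : forall x h, phi1 (x ⊙r h) - phi0 x ⊙r phi1 h = phi2 x (delta h);
  phi2_10 : forall h x, phi1 (h ⊙l x) - phi1 h ⊙l phi0 x = phi2 (delta h) x;
  phi2_mu : forall x y z,
    phi1 (mu x y z) - mu (phi0 x) (phi0 y) (phi0 z) =
    phi2 x (y ⊙ z) - phi2 (x ⊙ y) z + phi0 x ⊙r phi2 y z - phi2 x y ⊙l phi0 z }.

Record ainf_diff_op (k : fieldType) (a : ainf k) := AinfDiffOp {
  d0 :> {linear A0 a -> A0 a};
  d1 : {linear A1 a -> A1 a};
  d2 : {bilinear A0 a -> A0 a -> A1 a};
  d_delta : forall h, d0 (delta h) = delta (d1 h);
  d_D1 : forall x y, d0 x ⊙ y + x ⊙ d0 y + d0 x ⊙ d0 y - d0 (x ⊙ y) =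
    delta (d2 x y);
  d_D2 : forall x h, d0 x ⊙r h + x ⊙r d1 h + d0 x ⊙r d1 h - d1 (x ⊙r h) =
    d2 x (delta h);
  d_D3 : forall h x, d1 h ⊙l x + h ⊙l d0 x + d1 h ⊙l d0 x - d1 (h ⊙l x) =
    d2 (delta h) x;
  d_D4 : forall x y z,
    (x + d0 x) ⊙r d2 y z - d2 (x ⊙ y) z + d2 x (y ⊙ z) - d2 x y ⊙l (z + d0 z) =
    mu (d0 x) y z + mu x (d0 y) z + mu x y (d0 z) + mu (d0 x) (d0 y) z
      + mu (d0 x) y (d0 z) + mu x (d0 y) (d0 z) + mu (d0 x) (d0 y) (d0 z)
      - d1 (mu x y z) }.

Record diff_ainf (k : fieldType) := DiffAinf {
  da_alg :> ainf k;
  da_op : ainf_diff_op da_alg }.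

(* The last two products in [phi3_d2] are the degree 1 part of the morphism
   [F_3(x) • F_3(y)] that occurs in the coherence condition of a homomorphism of
   difference associative 2-algebras. They have total degree 1, as they multiply
   a value of [phi3] by the source or the target of the other factor, and
   without them these homomorphisms are not closed under composition. *)
Record diff_ainf_hom (k : fieldType) (a a' : diff_ainf k) := DiffAinfHom {
  dphi_hom :> ainf_hom a a';
  phi3 : {linear A0 a -> A1 a'};
  phi3_d0 : forall x,
    dphi_hom (da_op a x) - da_op a' (dphi_hom x) = delta (phi3 x);
  phi3_d1 : forall h,
    phi1 dphi_hom (d1 (da_op a) h) - d1 (da_op a') (phi1 dphi_hom h) =
    phi3 (delta h);
  phi3_d2 : forall x y,
    phi1 dphi_hom (d2 (da_op a) x y)
      - d2 (da_op a') (dphi_hom x) (dphi_hom y) =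
    (phi2 dphi_hom (da_op a x) y + phi2 dphi_hom x (da_op a y)
       + phi2 dphi_hom (da_op a x) (da_op a y) - phi3 (x ⊙ y))
    + (phi3 x ⊙l dphi_hom y + dphi_hom x ⊙r phi3 y
       - d1 (da_op a') (phi2 dphi_hom x y))
    + (phi3 x ⊙l da_op a' (dphi_hom y) + dphi_hom (da_op a x) ⊙r phi3 y) }.

Tactic Notation "lin" constr(f) := rewrite ?(linearD f) ?(linearN f).
Tactic Notation "lin" constr(f) "in" hyp(h) :=
  rewrite ?(linearD f) ?(linearN f) in h.
Tactic Notation "bil" constr(f) :=
  rewrite ?(linearDl f) ?(linearNl f) ?(linearDr f) ?(linearNr f).
Tactic Notation "bil" constr(f) "in" hyp(h) :=
  rewrite ?(linearDl f) ?(linearNl f) ?(linearDr f) ?(linearNr f) in h.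

Section AinfCat.
Variable k : fieldType.

Lemma ainf_hom_ext (a a' : ainf k) (f g : ainf_hom a a') :
  phi0 f = phi0 g -> phi1 f = phi1 g -> phi2 f = phi2 g -> f = g.
Proof.
case: f g => [f0 f1 f2 p q r s t] [g0 g1 g2 p' q' r' s' t'] /= e0 e1 e2.
case: g0 / e0 p' q' r' s' t' => p' q' r' s' t'.
case: g1 / e1 p' r' s' t' => p' r' s' t'.
case: g2 / e2 q' r' s' t' => q' r' s' t'.
by rewrite (proof_irrelevance _ p p') (proof_irrelevance _ q q')
  (proof_irrelevance _ r r') (proof_irrelevance _ s s') (proof_irrelevance _ t t').
Qed.

Lemma diff_ainf_hom_ext (a a' : diff_ainf k) (f g : diff_ainf_hom a a') :
  phi0 f =1 phi0 g -> phi1 f =1 phi1 g -> phi2 f =2 phi2 g ->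
  phi3 f =1 phi3 g -> f = g.
Proof.
move=> /linear_ext e0 /linear_ext e1 /bilinear_ext e2 /linear_ext.
have := ainf_hom_ext e0 e1 e2; move: f g {e0 e1 e2}.
move=> [f f3 p q r] [g g3 p' q' r'] /= e e3.
case: g / e p' q' r' => p' q' r'; case: g3 / e3 p' q' r' => p' q' r'.
by rewrite (proof_irrelevance _ p p') (proof_irrelevance _ q q')
           (proof_irrelevance _ r r').
Qed.

Lemma zero_bilinear (U V W : lmodType k) :
  bilinear_map (fun (_ : U) (_ : V) => 0 : W).
Proof. by split=> x c u v; rewrite scaler0 addr0. Qed.

Lemma zero_linear (U V : lmodType k) : linear (fun _ : U => 0 : V).
Proof. by move=> c u v; rewrite scaler0 addr0. Qed.

Section Id.
Variable a : diff_ainf k.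

Definition ainf_id : ainf_hom a a.
Proof.
refine (@AinfHom k a a [the {linear _ -> _} of idfun]
  [the {linear _ -> _} of idfun] (pack_bilinear (@zero_bilinear _ _ _))
  _ _ _ _ _) => //=.
- abstract (by move=> x y; rewrite subrr linear0).
- abstract (by move=> x h; rewrite subrr).
- abstract (by move=> h x; rewrite subrr).
- abstract (by move=> x y z; rewrite (linear0l (ai10 a)) (linear0r (ai01 a)); zmod).
Defined.

Definition diff_ainf_id : diff_ainf_hom a a.
Proof.
refine (@DiffAinfHom k a a ainf_id (pack_linear (@zero_linear _ _)) _ _ _) => /=.
- abstract (by move=> x; rewrite subrr linear0).
- abstract (by move=> h; rewrite subrr).
- abstract (by move=> x y; rewrite !(linear0l (ai10 a)) !(linear0r (ai01 a));
  rewrite (linear0 (d1 (da_op a))); zmod).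
Defined.

End Id.

Section Comp.
Variables (a a' a'' : diff_ainf k).
Variables (g : diff_ainf_hom a' a'') (f : diff_ainf_hom a a').

Lemma phi2_comp_bilinear :
  bilinear_map (fun x y => phi2 g (f x) (f y) + phi1 g (phi2 f x y)).
Proof.
split=> [y|x] c u v.
  rewrite (linearP f) linearPl (linearPl (phi2 f)) (linearP (phi1 g)).
  by rewrite scalerDr; zmod.
rewrite (linearP f) linearPr (linearPr (phi2 f)) (linearP (phi1 g)).
by rewrite scalerDr; zmod.
Qed.

Lemma phi3_comp_linear : linear (fun x => phi3 g (f x) + phi1 g (phi3 f x)).
Proof.
move=> c u v; rewrite (linearP f) (linearP (phi3 g)) (linearP (phi3 f)).
by rewrite (linearP (phi1 g)) scalerDr; zmod.
Qed.

Definition ainf_comp : ainf_hom a a''.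
Proof.
refine (@AinfHom k a a'' [the {linear _ -> _} of g \o f]
  [the {linear _ -> _} of phi1 g \o phi1 f] (pack_bilinear phi2_comp_bilinear)
  _ _ _ _ _) => /=.
- abstract (by move=> h; rewrite !phi_delta).
- abstract (move=> x y; have e1 := congr1 g (phi2_00 f x y);
  have e2 := phi2_00 g (f x) (f y); rewrite phi_delta in e1;
  lin g in e1; lin (@delta _ a''); zlin (congr2 +%R e1 e2)).
- abstract (move=> x h; have e1 := congr1 (phi1 g) (phi2_01 f x h);
  have e2 := phi2_01 g (f x) (phi1 f h); lin (phi1 g) in e1;
  rewrite phi_delta; zlin (congr2 +%R e1 e2)).
- abstract (move=> h x; have e1 := congr1 (phi1 g) (phi2_10 f h x);
  have e2 := phi2_10 g (phi1 f h) (f x); lin (phi1 g) in e1;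
  rewrite phi_delta; zlin (congr2 +%R e1 e2)).
- abstract (move=> x y z; have e1 := congr1 (phi1 g) (phi2_mu f x y z);
  have e2 := phi2_mu g (f x) (f y) (f z);
  have e3 := phi2_01 g (f x) (phi2 f y z);
  have e4 := phi2_10 g (phi2 f x y) (f z);
  have e5 := congr1 (phi2 g (f x)) (phi2_00 f y z);
  have e6 := congr1 ((phi2 g)^~ (f z)) (phi2_00 f x y);
  lin (phi1 g) in e1; rewrite /= in e6; bil (phi2 g) in e5; bil (phi2 g) in e6;
  lin (phi1 g); bil (ai01 a''); bil (ai10 a'');
  zlin (congr2 +%R (congr2 +%R e1 e2) (congr2 +%R (congr2 +%R e3 (esym e4))
    (congr2 +%R (esym e5) e6)))).
Defined.

Lemma phi3_d2_comp x y (h := ainf_comp) :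
  let h3 x := phi3 g (f x) + phi1 g (phi3 f x) in
  phi1 h (d2 (da_op a) x y) - d2 (da_op a'') (h x) (h y) =
    (phi2 h (da_op a x) y + phi2 h x (da_op a y)
       + phi2 h (da_op a x) (da_op a y) - h3 (x ⊙ y))
    + (h3 x ⊙l h y + h x ⊙r h3 y - d1 (da_op a'') (phi2 h x y))
    + (h3 x ⊙l da_op a'' (h y) + h (da_op a x) ⊙r h3 y).
Proof.
move=> /=; set D := da_op a; set D' := da_op a'; set D'' := da_op a''.
have e1 := congr1 (phi1 g) (phi3_d2 f x y).
have e2 := phi3_d2 g (f x) (f y).
have m1 := phi2_10 g (phi3 f x) (f y).
have m2 := phi2_01 g (f x) (phi3 f y).
have m3 := phi2_10 g (phi3 f x) (D' (f y)).
have m4 := phi2_01 g (f (D x)) (phi3 f y).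
have p1 := congr1 ((phi2 g)^~ (f y)) (phi3_d0 f x).
have p2 := congr1 (phi2 g (f x)) (phi3_d0 f y).
have p3 := congr1 ((phi2 g)^~ (D' (f y))) (phi3_d0 f x).
have p4 := congr1 (phi2 g (f (D x))) (phi3_d0 f y).
have q := congr1 (phi3 g) (phi2_00 f x y).
have r := phi3_d1 g (phi2 f x y).
have s1 := congr1 (ai10 a'' (phi1 g (phi3 f x))) (phi3_d0 g (f y)).
have s2 := ai_A3 (phi1 g (phi3 f x)) (phi3 g (f y)).
have s3 := congr1 ((ai01 a'')^~ (phi3 g (f y))) (phi_delta g (phi3 f x)).
have s4 := congr1 (fun z => ai01 a'' (g z) (phi3 g (f y))) (phi3_d0 f x).
rewrite /= in p1 p3 s3 s4; lin (phi1 g) in e1; bil (phi2 g) in p1.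
bil (phi2 g) in p2; bil (phi2 g) in p3; bil (phi2 g) in p4; lin (phi3 g) in q.
bil (ai10 a'') in s1; lin g in s4; bil (ai01 a'') in s4.
bil (ai10 a''); bil (ai01 a''); lin (d1 D'').
zlin (congr2 +%R (congr2 +%R (congr2 +%R e1 e2)
  (congr2 +%R (congr2 +%R m1 m2) (congr2 +%R m3 m4)))
  (congr2 +%R (congr2 +%R (congr2 +%R q (esym r)) s1)
  (esym (congr2 +%R (congr2 +%R (congr2 +%R p1 p2) (congr2 +%R p3 p4))
  (congr2 +%R (congr2 +%R s2 s3) s4))))).
Qed.

Definition diff_ainf_comp : diff_ainf_hom a a''.
Proof.
refine (@DiffAinfHom k a a'' ainf_comp (pack_linear phi3_comp_linear) _ _ _) => /=.
- abstract (move=> x; have e1 := congr1 g (phi3_d0 f x);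
  have e2 := phi3_d0 g (f x); rewrite phi_delta in e1;
  lin g in e1; lin (@delta _ a''); zlin (congr2 +%R e1 e2)).
- abstract (move=> h; have e1 := congr1 (phi1 g) (phi3_d1 f h);
  have e2 := phi3_d1 g (phi1 f h); lin (phi1 g) in e1;
  rewrite phi_delta; zlin (congr2 +%R e1 e2)).
- exact: phi3_d2_comp.
Defined.

End Comp.

Lemma diff_ainf_compA (a1 a2 a3 a4 : diff_ainf k) (h : diff_ainf_hom a3 a4)
    (g : diff_ainf_hom a2 a3) (f : diff_ainf_hom a1 a2) :
  diff_ainf_comp h (diff_ainf_comp g f) = diff_ainf_comp (diff_ainf_comp h g) f.
Proof.
apply: diff_ainf_hom_ext => // [x y|x] /=.
- by lin (phi1 h); zmod.
- by lin (phi1 h); zmod.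
Qed.

Lemma diff_ainf_comp1l (a a' : diff_ainf k) (f : diff_ainf_hom a a') :
  diff_ainf_comp (diff_ainf_id a') f = f.
Proof. by apply: diff_ainf_hom_ext => // [x y|x] /=; rewrite add0r. Qed.

Lemma diff_ainf_comp1r (a a' : diff_ainf k) (f : diff_ainf_hom a a') :
  diff_ainf_comp f (diff_ainf_id a) = f.
Proof.
by apply: diff_ainf_hom_ext => // [x y|x] /=; rewrite (linear0 (phi1 f)) addr0.
Qed.

Definition TwoTermDiffAinf : category :=
  Category diff_ainf_compA diff_ainf_comp1l diff_ainf_comp1r.

End AinfCat.

(* Main.v *)
From HB Require Import structures.
From mathcomp Require Import all_boot all_order all_algebra.
From mathcomp Require Import sesquilinear.
Require Import Defs.

(** A 2-vector space is the same thing as a 2-term complex. A morphism [f] of a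
    2-vector space [C] is the sum of the identity of its source and of its arrow
    part [arrow_part f = f - idt C (src f)], which lies in the kernel of the
    source map; conversely, a linear map [δ : A1 -> A0] gives a category with
    objects [A0] in which a pair [(x, h)] is an arrow from [x] to [x + δ h].
    Composition carries no information, since linearity forces
    [g ∘ f = g + f - 1]; in particular, every morphism is invertible and
    composition becomes the addition of arrow parts.

    The equivalence upgrades this dictionary. The functor [diff_ainf_functor]
    sends [C] to the complex [tgt : ker src -> Ob C] and replaces each structural
    natural isomorphism (the associator, the isomorphism of the difference
    operator, the two isomorphisms of a homomorphism) by its arrow part. A bilinear
    functor acts on arrow parts by
    [arrow_part (f ⊡ g) = arrow_part f ⋊ src g + tgt f ⋉ arrow_part g]
    ([arrow_part_hbul]). With this rule the axioms match one by one. The source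
    and the target of a structural isomorphism give the axioms on its boundary;
    naturality at identities and at one morphism out of [0] gives the axioms with
    one argument of degree 1; coherence gives the cocycle axioms; and the
    interchange law gives [ai_A3].

    The functor [diff2_functor] goes back along the same formulas, the second
    component of [(x, h)] being the arrow part. Naturality at arbitrary morphisms
    is recovered from the axioms with one argument of degree 1 by telescoping: the
    value of a multilinear map at the targets minus its value at the sources is
    a sum of terms in which one argument is a boundary ([cx_boundary]).

    Both composites are isomorphic to the identity by strict maps, which are the
    identity on objects: [(0, h)] corresponds to [h] ([kernel_proj_iso]), and a
    morphism [f] to the pair [(src f, arrow_part f)] ([split_iso]). *)

Set Implicit Arguments.
Unset Strict Implicit.
Unset Printing Implicit Defensive.

Import GRing.Theory.
Local Open Scope ring_scope.
Local Open Scope hom_scope.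
Local Open Scope ainf_scope.

(** * Kernels and the arrow part of a morphism *)

Section Kernel.
Variables (k : fieldType) (U V : lmodType k) (f : {linear U -> V}).

Definition in_kernel : {pred U} := [pred x | f x == 0].

Lemma in_kernel_submod : submod_closed in_kernel.
Proof.
split; first by rewrite inE linear0.
by move=> a x y; rewrite !inE linearP => /eqP-> /eqP->; rewrite scaler0 addr0.
Qed.

HB.instance Definition _ :=
  GRing.isSubmodClosed.Build k U in_kernel in_kernel_submod.

(** The kernel is a subtype, and not a subspace in the sense of finite-dimensional
    linear algebra: the vector spaces here are arbitrary. *)
Record kernel := Kernel { kval : U; kvalP : kval \in in_kernel }.

HB.instance Definition _ := [isSub for kval].
HB.instance Definition _ := [Choice of kernel by <:].
HB.instance Definition _ := [SubChoice_isSubLmodule of kernel by <:].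

Lemma kval_inj : injective kval. Proof. exact: val_inj. Qed.

Lemma kval_linear : linear kval.
Proof. by move=> a x y; exact: (linearP (val : kernel -> U)). Qed.

HB.instance Definition _ := GRing.isLinear.Build k kernel U *:%R kval kval_linear.

Lemma kval0 (h : kernel) : f (kval h) = 0.
Proof. exact/eqP/(kvalP h). Qed.

End Kernel.

Notation ker C := (kernel (@src _ C)).

Section ArrowPart.
Variables (k : fieldType) (C : two_vect k).

Lemma arrow_part_kernel (f : Mor C) : f - idt C (src f) \in in_kernel (@src k C).
Proof. by rewrite inE linearB /= src_idt subrr. Qed.

(** The component of [f] in the splitting of [Mor C] as the sum of [Ob C] and
    [ker C]: two parallel morphisms with the same arrow part are equal. Being
    linear with values in [ker C], it makes each structure map of a 2-algebra
    into a (multi)linear map of the 2-term complex. *)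
Definition arrow_part (f : Mor C) : ker C := Kernel (arrow_part_kernel f).

Lemma arrow_part_linear : linear arrow_part.
Proof.
move=> a f g; apply: kval_inj; rewrite (linearP (@kval _ _ _ _)) /= linearP.
by rewrite (linearP (idt C)) scalerDr scalerN; zmod.
Qed.

HB.instance Definition _ :=
  GRing.isLinear.Build k (Mor C) (ker C) *:%R arrow_part arrow_part_linear.

Lemma kval_arrow_part f : kval (arrow_part f) = f - idt C (src f).
Proof. by []. Qed.

Lemma arrow_partK (h : ker C) : arrow_part (kval h) = h.
Proof. by apply: kval_inj; rewrite /= kval0 linear0 subr0. Qed.

Lemma arrow_part_idt x : arrow_part (idt C x) = 0.
Proof. by apply: kval_inj; rewrite /= src_idt subrr. Qed.

(** Composition is forced by linearity to be [g + f - idt C y], which loses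
    exactly the common identity: coherence conditions, which are equalities of
    composites, become identities in the abelian group [ker C]. *)
Lemma arrow_part_hcomp x y z (g : hom y z) (f : hom x y) :
  arrow_part (g ∘ f) = arrow_part g + arrow_part f.
Proof.
apply: kval_inj; rewrite kval_arrow_part hsrc hcompE (linearD (@kval _ _ _ _)) /=.
by rewrite !hsrc; zmod.
Qed.

Lemma arrow_part_hid x : arrow_part (hid x : hom x x) = 0.
Proof. exact: arrow_part_idt. Qed.

Lemma arrow_part_hadd x y x' y' (f : hom x y) (g : hom x' y') :
  arrow_part (f ⊞ g) = arrow_part f + arrow_part g.
Proof. exact: linearD. Qed.

Lemma arrow_part_hretarget x y y' (e : y = y') (f : hom x y) :
  arrow_part (hretarget e f) = arrow_part f.
Proof. by []. Qed.

Lemma tgt_arrow_part x y (f : hom x y) : tgt (kval (arrow_part f)) = y - x.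
Proof. by rewrite /= linearB /= tgt_idt hsrc htgt. Qed.

Definition mor_hom (f : Mor C) : hom (src f) (tgt f) := Hom erefl erefl.

(** Elements of [ker C] are the morphisms out of [0]. Naturality squares taken at
    such a morphism and at identities yield the axioms with one argument of
    degree 1. *)
Definition kernel_hom (h : ker C) : hom 0 (tgt (kval h)) := Hom (kval0 h) erefl.

Lemma arrow_part_kernel_hom h : arrow_part (kernel_hom h) = h.
Proof. exact: arrow_partK. Qed.

End ArrowPart.

Definition kernel_map (k : fieldType) (C C' : two_vect k) (F : lin_functor C C') :
    {linear ker C -> ker C'} :=
  [the {linear _ -> _} of @arrow_part k C' \o lf_mor F \o @kval _ _ _ _].

Lemma arrow_part_hmap (k : fieldType) (C C' : two_vect k) (F : lin_functor C C')
    x y (f : hom x y) :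
  arrow_part (hmap F f) = kernel_map F (arrow_part f).
Proof.
rewrite /kernel_map /= linearB /= lf_idt [RHS]linearB /=.
by rewrite arrow_part_idt subr0.
Qed.

Lemma tgt_kernel_map (k : fieldType) (C C' : two_vect k) (F : lin_functor C C') h :
  F (tgt (kval h)) = tgt (kval (kernel_map F h)).
Proof. by rewrite /= linearB /= tgt_idt lf_src lf_tgt kval0 linear0 subr0. Qed.

Section KernelProducts.
Variables (k : fieldType) (C : two_vect k) (B : bilin_functor C).

Lemma kernel_lmul_bilinear :
  bilinear_map (fun (x : Ob C) (h : ker C) =>
    arrow_part (bf_mor B (idt C x) (kval h))).
Proof.
split=> [h|x] a u v.
  by rewrite (linearP (idt C)) linearPl linearP.
by rewrite (linearP (@kval _ _ _ _)) linearPr linearP.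
Qed.

Lemma kernel_rmul_bilinear :
  bilinear_map (fun (h : ker C) (x : Ob C) =>
    arrow_part (bf_mor B (kval h) (idt C x))).
Proof.
split=> [x|h] a u v.
  by rewrite (linearP (@kval _ _ _ _)) linearPl linearP.
by rewrite (linearP (idt C)) linearPr linearP.
Qed.

Definition kernel_lmul : {bilinear Ob C -> ker C -> ker C} :=
  pack_bilinear kernel_lmul_bilinear.
Definition kernel_rmul : {bilinear ker C -> Ob C -> ker C} :=
  pack_bilinear kernel_rmul_bilinear.

Lemma hbulE x y x' y' (f : hom x y) (g : hom x' y') :
  hmor (hbul B f g) = bf_mor B (hmor f) (hmor g).
Proof. by []. Qed.

(** The interchange law, applied to the two ways of placing identities around
    [h : 0 -> tgt h] and [l : 0 -> tgt l]. *)
Lemma bf_mor_kernel (h l : ker C) :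
  bf_mor B (kval h) (kval l) = bf_mor B (kval h) (idt C (tgt (kval l))) /\
  bf_mor B (kval h) (kval l) = bf_mor B (idt C (tgt (kval h))) (kval l).
Proof.
have := hmor_eq (hbul_comp B (kernel_hom h) (hid 0)
                             (hid (tgt (kval l))) (kernel_hom l)).
have := hmor_eq (hbul_comp B (hid (tgt (kval h))) (kernel_hom h)
                             (kernel_hom l) (hid 0)).
rewrite !hbulE !hcompE !hbulE /= !(linear0, linear0l, linear0r, oppr0, addr0).
by rewrite !(addrC (idt C _)) !addrK => -> ->.
Qed.

(** Both sides are the product of [h] and [l] as morphisms. *)
Lemma kernel_mul_balanced (h l : ker C) :
  kernel_lmul (tgt (kval h)) l = kernel_rmul h (tgt (kval l)).
Proof. by have [e1 e2] := bf_mor_kernel h l; rewrite /= -e1 -e2. Qed.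

Lemma kernel_lmul_src x (h : ker C) : src (bf_mor B (idt C x) (kval h)) = 0.
Proof. by rewrite bf_src kval0 linear0r. Qed.

Lemma kernel_rmul_src (h : ker C) x : src (bf_mor B (kval h) (idt C x)) = 0.
Proof. by rewrite bf_src kval0 linear0l. Qed.

Lemma tgt_kernel_lmul x h :
  tgt (kval (kernel_lmul x h)) = bf_ob B x (tgt (kval h)).
Proof.
by rewrite /= kernel_lmul_src linear0 subr0 bf_tgt tgt_idt.
Qed.

Lemma tgt_kernel_rmul h x :
  tgt (kval (kernel_rmul h x)) = bf_ob B (tgt (kval h)) x.
Proof.
by rewrite /= kernel_rmul_src linear0 subr0 bf_tgt tgt_idt.
Qed.

(** The product is the composite of [f ⊡ 1] followed by [1 ⊡ g]. The opposite
    factorization gives a formula with the source of [f] and the target of [g],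
    equal to this one by [kernel_mul_balanced]; the form chosen here is the one
    that occurs in [phi3_d2]. *)
Lemma arrow_part_hbul x x' y y' (f : hom x x') (g : hom y y') :
  arrow_part (hbul B f g) =
  kernel_rmul (arrow_part f) y + kernel_lmul x' (arrow_part g).
Proof.
have -> : hbul B f g = hbul B (hid x') g ∘ hbul B f (hid y).
  rewrite -hbul_comp; congr (hbul B _ _); apply: hom_ext; rewrite hcompE /=; zmod.
rewrite arrow_part_hcomp addrC; congr (_ + _); rewrite /=.
  by rewrite hsrc linearBl bf_idt linearB /= arrow_part_idt subr0.
by rewrite hsrc linearBr bf_idt linearB /= arrow_part_idt subr0.
Qed.

End KernelProducts.

(** Translates a diagram of morphisms into an identity between degree 1
    elements. *)
Definition arrow_partE :=
  (arrow_part_hcomp, arrow_part_hadd, arrow_part_hbul, arrow_part_hmap,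
   arrow_part_hretarget, arrow_part_hid).

Section Trilinear.
Variables (k : fieldType) (U V W T : lmodType k) (f : U -> V -> W -> T).
Hypothesis f_trilinear : trilinear_map f.

Lemma trilinear_subl x x' y z : f (x - x') y z = f x y z - f x' y z.
Proof. by have [e _ _] := f_trilinear; exact: (linearB (pack_linear (e y z))). Qed.

Lemma trilinear_subm x y y' z : f x (y - y') z = f x y z - f x y' z.
Proof. by have [_ e _] := f_trilinear; exact: (linearB (pack_linear (e x z))). Qed.

Lemma trilinear_subr x y z z' : f x y (z - z') = f x y z - f x y z'.
Proof. by have [_ _ e] := f_trilinear; exact: (linearB (pack_linear (e x y))). Qed.

Lemma trilinear0l y z : f 0 y z = 0.
Proof. by have [e _ _] := f_trilinear; exact: (linear0 (pack_linear (e y z))). Qed.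

Lemma trilinear0m x z : f x 0 z = 0.
Proof. by have [_ e _] := f_trilinear; exact: (linear0 (pack_linear (e x z))). Qed.

Lemma trilinear0r x y : f x y 0 = 0.
Proof. by have [_ _ e] := f_trilinear; exact: (linear0 (pack_linear (e x y))). Qed.

End Trilinear.

(** * From 2-algebras to 2-term algebras *)

Notation "x ⋉ h" := (kernel_lmul (bul _) x h) (at level 40, left associativity).
Notation "h ⋊ x" := (kernel_rmul (bul _) h x) (at level 40, left associativity).

Section AinfOfAssoc2.
Variables (k : fieldType) (C : assoc2 k).

Definition ker_mu (x y z : Ob C) : ker C := arrow_part (asc x y z).

Lemma ker_mu_trilinear : trilinear_map ker_mu.
Proof.
have [e1 e2 e3] := asc_trilinear C.
by split=> x y c u v; rewrite /ker_mu (e1, e2, e3) linearP.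
Qed.

Let lmul0 x : kernel_lmul (bul C) x 0 = 0. Proof. exact: linear0r. Qed.
Let rmul0 x : kernel_rmul (bul C) 0 x = 0. Proof. exact: linear0l. Qed.

(** Naturality of the associator in a form that specializes to [ai_A5], [ai_A6]
    and [ai_A7]: [ker_mu] changes along [f], [g], [h] by the failure of
    associativity of these morphisms. *)
Lemma ker_mu_natural x x' y y' z z' (f : hom x x') (g : hom y y') (h : hom z z') :
  arrow_part (f ⊡ (g ⊡ h))%hom - arrow_part (f ⊡ g ⊡ h)%hom =
  ker_mu x' y' z' - ker_mu x y z.
Proof.
have := congr1 (@arrow_part _ _) (hmor_eq (asc_natural f g h)).
rewrite !arrow_part_hcomp => e.
zlin (esym e).
Qed.

Lemma ker_mu_r x y (h : ker C) :
  x ⋉ (y ⋉ h) - x • y ⋉ h = ker_mu x y (tgt (kval h)).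
Proof.
have := ker_mu_natural (hid x) (hid y) (kernel_hom h).
by rewrite !arrow_partE arrow_part_kernel_hom !(rmul0, lmul0, add0r)
  (trilinear0r ker_mu_trilinear) subr0.
Qed.

Lemma ker_mu_m x (h : ker C) y :
  x ⋉ (h ⋊ y) - x ⋉ h ⋊ y = ker_mu x (tgt (kval h)) y.
Proof.
have := ker_mu_natural (hid x) (kernel_hom h) (hid y).
by rewrite !arrow_partE arrow_part_kernel_hom !(rmul0, lmul0, add0r, addr0)
  (trilinear0m ker_mu_trilinear) subr0.
Qed.

Lemma ker_mu_l (h : ker C) x y :
  h ⋊ (x • y) - h ⋊ x ⋊ y = ker_mu (tgt (kval h)) x y.
Proof.
have := ker_mu_natural (kernel_hom h) (hid x) (hid y).
by rewrite !arrow_partE arrow_part_kernel_hom !(rmul0, lmul0, addr0)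
  (trilinear0l ker_mu_trilinear) subr0.
Qed.

(** The arrow part of the pentagon. *)
Lemma ker_mu_cocycle x y z t :
  x ⋉ ker_mu y z t - ker_mu (x • y) z t + ker_mu x (y • z) t
    - ker_mu x y (z • t) + ker_mu x y z ⋊ t = 0.
Proof.
have := congr1 (@arrow_part _ _) (hmor_eq (asc_coherence x y z t)).
rewrite !arrow_partE rmul0 lmul0 add0r addr0 => e.
zlin e.
Qed.

Definition ker_delta : {linear ker C -> Ob C} :=
  [the {linear _ -> _} of tgt \o @kval _ _ _ _].

Definition ainf_of : ainf k :=
  @Ainf k (Ob C) (ker C) ker_delta
    (bf_ob (bul C)) (kernel_lmul (bul C)) (kernel_rmul (bul C)) ker_mu
    ker_mu_trilinear (@tgt_kernel_lmul _ _ _) (@tgt_kernel_rmul _ _ _)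
    (@kernel_mul_balanced _ _ _) (fun x y z => esym (tgt_arrow_part (asc x y z)))
    ker_mu_r ker_mu_m ker_mu_l ker_mu_cocycle.

End AinfOfAssoc2.

Section DiffAinfOfDiff2.
Variables (k : fieldType) (C : diff2 k).
Let D := df_op C.

Lemma ker_d2_bilinear : bilinear_map (fun x y => arrow_part (do2 D x y)).
Proof.
by have [e1 e2] := do2_bilinear D; split=> x c u v; rewrite (e1, e2) linearP.
Qed.

Definition ker_d2 : {bilinear Ob C -> Ob C -> ker C} := pack_bilinear ker_d2_bilinear.

Lemma ker_d2_natural x x' y y' (f : hom x x') (g : hom y y') :
  arrow_part (hmap D f ⊡ g)%hom + arrow_part (f ⊡ hmap D g)%hom
    + arrow_part (hmap D f ⊡ hmap D g)%hom - arrow_part (hmap D (f ⊡ g))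
  = ker_d2 x' y' - ker_d2 x y.
Proof.
have := congr1 (@arrow_part _ _) (hmor_eq (do2_natural D f g)).
rewrite 2!arrow_part_hcomp !arrow_part_hadd => e.
zlin (esym e).
Qed.

Lemma ker_d2_r x (h : ker C) :
  D x ⋉ h + x ⋉ kernel_map D h + D x ⋉ kernel_map D h - kernel_map D (x ⋉ h) =
  ker_d2 x (tgt (kval h)).
Proof.
have := ker_d2_natural (hid x) (kernel_hom h).
by rewrite !arrow_partE arrow_part_kernel_hom
  !(linear0, linear0l, linear0r, add0r, subr0).
Qed.

Lemma ker_d2_l (h : ker C) x :
  kernel_map D h ⋊ x + h ⋊ D x + kernel_map D h ⋊ D x - kernel_map D (h ⋊ x) =
  ker_d2 (tgt (kval h)) x.
Proof.
have := ker_d2_natural (kernel_hom h) (hid x).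
by rewrite !arrow_partE arrow_part_kernel_hom
  !(linear0, linear0l, linear0r, addr0, subr0).
Qed.

(** The arrow part of the coherence of the difference operator; each associator
    contributes a [ker_mu], and the products with identities contribute the
    actions on [ker_d2]. *)
Lemma ker_d2_mu (x y z : Ob C) :
  (x + D x) ⋉ ker_d2 y z - ker_d2 (x • y) z + ker_d2 x (y • z)
    - ker_d2 x y ⋊ (z + D z) =
  ker_mu (D x) y z + ker_mu x (D y) z + ker_mu x y (D z) + ker_mu (D x) (D y) z
    + ker_mu (D x) y (D z) + ker_mu x (D y) (D z) + ker_mu (D x) (D y) (D z)
    - kernel_map D (ker_mu x y z).
Proof.
have := congr1 (@arrow_part _ _) (do2_coherence D x y z).
rewrite 4!arrow_part_hcomp arrow_part_hretarget !arrow_partE.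
rewrite !(linear0, linear0l, linear0r, add0r, addr0) linearDl linearDr => e.
zlin (esym e).
Qed.

Definition ainf_diff_op_of : ainf_diff_op (ainf_of C) :=
  @AinfDiffOp k (ainf_of C) D (kernel_map D) ker_d2 (@tgt_kernel_map _ _ _ D)
    (fun x y => esym (tgt_arrow_part (do2 D x y))) ker_d2_r ker_d2_l ker_d2_mu.

Definition diff_ainf_of : diff_ainf k := DiffAinf ainf_diff_op_of.

End DiffAinfOfDiff2.

Section DiffAinfHomOfDiff2Hom.
Variables (k : fieldType) (C C' : diff2 k) (F : diff2_hom C C').
Let D := df_op C.
Let D' := df_op C'.

Lemma ker_phi2_bilinear : bilinear_map (fun x y => arrow_part (ah2 F x y)).
Proof.
by have [e1 e2] := ah2_bilinear F; split=> x c u v; rewrite (e1, e2) linearP.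
Qed.

Definition ker_phi2 : {bilinear Ob C -> Ob C -> ker C'} :=
  pack_bilinear ker_phi2_bilinear.

Lemma ker_phi2_natural x x' y y' (f : hom x x') (g : hom y y') :
  arrow_part (hmap F (f ⊡ g)) - arrow_part (hmap F f ⊡ hmap F g)%hom =
  ker_phi2 x' y' - ker_phi2 x y.
Proof.
have := congr1 (@arrow_part _ _) (hmor_eq (ah2_natural F f g)).
rewrite 2!arrow_part_hcomp => e.
zlin (esym e).
Qed.

Lemma ker_phi2_r (x : Ob C) (h : ker C) :
  kernel_map F (x ⋉ h) - F x ⋉ kernel_map F h = ker_phi2 x (tgt (kval h)).
Proof.
have := ker_phi2_natural (hid x) (kernel_hom h).
by rewrite !arrow_partE arrow_part_kernel_hom
  !(linear0, linear0l, linear0r, add0r, subr0).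
Qed.

Lemma ker_phi2_l (h : ker C) (x : Ob C) :
  kernel_map F (h ⋊ x) - kernel_map F h ⋊ F x = ker_phi2 (tgt (kval h)) x.
Proof.
have := ker_phi2_natural (kernel_hom h) (hid x).
by rewrite !arrow_partE arrow_part_kernel_hom
  !(linear0, linear0l, linear0r, addr0, subr0).
Qed.

Lemma ker_phi2_mu (x y z : Ob C) :
  kernel_map F (ker_mu x y z) - ker_mu (F x) (F y) (F z) =
  ker_phi2 x (y • z) - ker_phi2 (x • y) z + F x ⋉ ker_phi2 y z
  - ker_phi2 x y ⋊ F z.
Proof.
have := congr1 (@arrow_part _ _) (hmor_eq (ah2_coherence F x y z)).
rewrite !arrow_partE !(linear0, linear0l, linear0r, add0r, addr0) => e.
zlin (esym e).
Qed.

Definition ainf_hom_of : ainf_hom (ainf_of C) (ainf_of C') :=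
  @AinfHom k (ainf_of C) (ainf_of C') F (kernel_map F) ker_phi2
    (@tgt_kernel_map _ _ _ F) (fun x y => esym (tgt_arrow_part (ah2 F x y)))
    ker_phi2_r ker_phi2_l ker_phi2_mu.

Lemma ker_phi3_linear : linear (fun x => arrow_part (dh3 F x)).
Proof. by move=> c u v; rewrite dh3_linear linearP. Qed.

Definition ker_phi3 : {linear Ob C -> ker C'} := pack_linear ker_phi3_linear.

Lemma ker_phi3_delta (h : ker C) :
  kernel_map F (kernel_map D h) - kernel_map D' (kernel_map F h) =
  ker_phi3 (tgt (kval h)).
Proof.
have := congr1 (@arrow_part _ _) (hmor_eq (dh3_natural F (kernel_hom h))).
rewrite 2!arrow_part_hcomp !arrow_part_hmap arrow_part_kernel_hom => e.
have e0 : arrow_part (dh3 F 0) = 0 by exact: (linear0 ker_phi3).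
rewrite e0 addr0 in e.
zlin (esym e).
Qed.

(** The last line comes from the product [dh3 F x ⊡ dh3 F y], whose arrow part
    involves the source [D' (F y)] of its second factor and the target
    [F (D x)] of its first. *)
Lemma ker_phi3_d2 (x y : Ob C) :
  kernel_map F (ker_d2 C x y) - ker_d2 C' (F x) (F y) =
  (ker_phi2 (D x) y + ker_phi2 x (D y) + ker_phi2 (D x) (D y) - ker_phi3 (x • y))
  + (ker_phi3 x ⋊ F y + F x ⋉ ker_phi3 y - kernel_map D' (ker_phi2 x y))
  + (ker_phi3 x ⋊ D' (F y) + F (D x) ⋉ ker_phi3 y).
Proof.
have := congr1 (@arrow_part _ _) (dh3_coherence F x y).
rewrite !arrow_partE !(linear0, linear0l, linear0r, add0r, addr0) => e.
zlin e.
Qed.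

Definition diff_ainf_hom_of : diff_ainf_hom (diff_ainf_of C) (diff_ainf_of C') :=
  @DiffAinfHom k (diff_ainf_of C) (diff_ainf_of C') ainf_hom_of ker_phi3
    (fun x => esym (tgt_arrow_part (dh3 F x))) ker_phi3_delta ker_phi3_d2.

End DiffAinfHomOfDiff2Hom.

Lemma diff_ainf_hom_of_id (k : fieldType) (C : diff2 k) :
  diff_ainf_hom_of (diff2_id C) = diff_ainf_id (diff_ainf_of C).
Proof.
apply: diff_ainf_hom_ext => // [h|x y|x].
- exact: arrow_partK.
- exact: arrow_part_idt.
- exact: arrow_part_idt.
Qed.

Lemma diff_ainf_hom_of_comp (k : fieldType) (C C' C'' : diff2 k)
    (G : diff2_hom C' C'') (F : diff2_hom C C') :
  diff_ainf_hom_of (diff2_comp G F) =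
  diff_ainf_comp (diff_ainf_hom_of G) (diff_ainf_hom_of F).
Proof.
apply: diff_ainf_hom_ext => // [h|x y|x].
- exact: (arrow_part_hmap G (hmap F (kernel_hom h))).
- by rewrite [LHS]arrow_part_hcomp arrow_part_hmap addrC.
- by rewrite [LHS]arrow_part_hcomp arrow_part_hmap addrC.
Qed.

Definition diff_ainf_functor (k : fieldType) :
    functor (DiffAss2 k) (TwoTermDiffAinf k) :=
  @Functor (DiffAss2 k) (TwoTermDiffAinf k) (@diff_ainf_of k)
    (@diff_ainf_hom_of k) (@diff_ainf_hom_of_id k)
    (fun C C' C'' G F => diff_ainf_hom_of_comp G F).

(** * From 2-term algebras to 2-algebras *)

Section TwoVectOfComplex.
Variables (k : fieldType) (U1 U0 : lmodType k) (d : {linear U1 -> U0}).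
Let M : lmodType k := (U0 * U1)%type.

Lemma cx_tgt_linear : linear (fun f : M => f.1 + d f.2).
Proof. by move=> a f g /=; rewrite linearP scalerDr; zmod. Qed.

Lemma cx_idt_linear : linear (fun x : U0 => (x, 0) : M).
Proof. by move=> a x y; congr pair; rewrite /= scaler0 addr0. Qed.

Definition cx_src : {linear M -> U0} := [the {linear _ -> _} of fst].
Definition cx_tgt := pack_linear cx_tgt_linear.
Definition cx_idt := pack_linear cx_idt_linear.

Definition cx_comp (g f : M) (_ : cx_src g = cx_tgt f) : M := (f.1, g.2 + f.2).

(** The category of a complex [d : U1 -> U0]: the pair [(x, h)] is an arrow from
    [x] to [x + d h], and composition adds the second components. *)
Definition two_vect_of : two_vect k.
Proof.
refine (@TwoVect k U0 M cx_src cx_tgt cx_idt cx_comp _ _ _ _ _ _ _ _); rewrite /cx_comp.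
- by [].
- abstract (by move=> x; rewrite /= linear0 addr0).
- by [].
- abstract (by move=> g f /= ->; rewrite linearD; zmod).
- abstract (by move=> [x h] e; rewrite /= add0r).
- abstract (by move=> [x h] e; rewrite /= addr0).
- abstract (by move=> h g f hg gf h_gf hg_f; rewrite /= addrA).
- abstract (by move=> a g f g' f' e e' e''; congr pair; rewrite /= scalerDr; zmod).
Defined.

End TwoVectOfComplex.

Section TwoVectOfComplexTheory.
Variables (k : fieldType) (U1 U0 : lmodType k) (d : {linear U1 -> U0}).
Implicit Types x y z : Ob (two_vect_of d).

(** The second component is the arrow part for these 2-vector spaces: together
    with the ends it determines the arrow, and each operation on arrows acts on
    it by the same formula as on arrow parts. *)
Lemma cx_homP x y (f g : hom x y) : (hmor f).2 = (hmor g).2 -> f = g.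
Proof.
move=> e; apply: hom_ext; move: (hsrc f) (hsrc g) e.
by case: (hmor f) (hmor g) => [f1 f2] [g1 g2] /= -> -> ->.
Qed.

Lemma cx_boundary x y (f : hom x y) : d (hmor f).2 = y - x.
Proof. by case: f => [[u h] /= <- <-]; rewrite addrC addKr. Qed.

Lemma cx_snd_hcomp x y z (g : hom y z) (f : hom x y) :
  (hmor (g ∘ f)).2 = (hmor g).2 + (hmor f).2.
Proof. by []. Qed.

Lemma cx_snd_hadd x y x' y' (f : hom x y) (g : hom x' y') :
  (hmor (f ⊞ g)).2 = (hmor f).2 + (hmor g).2.
Proof. by []. Qed.

Lemma cx_snd_hretarget x y y' (e : y = y') (f : hom x y) :
  (hmor (hretarget e f)).2 = (hmor f).2.
Proof. by []. Qed.

Lemma cx_snd_hid x : (hmor (hid x : hom x x)).2 = 0.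
Proof. by []. Qed.

Definition cx_hom x y (h : U1) (e : d h = y - x) : hom x y.
Proof.
apply: (@Hom k (two_vect_of d) x y (x, h)) => //=.
abstract (by rewrite e addrC subrK).
Defined.

End TwoVectOfComplexTheory.

Section Assoc2OfAinf.
Variables (k : fieldType) (a : ainf k).

Notation C := (two_vect_of (@delta k a)).

(** Expanded, the second component is [h ⊙ y + x ⊙ l + δ h ⊙ l] for
    [f = (x, h)] and [g = (y, l)]; using the target of [f] absorbs the last
    term. *)
Lemma cx_mul_bilinear : bilinear_map (fun f g : Mor C =>
  (f.1 ⊙ g.1, f.2 ⊙l g.1 + tgt f ⊙r g.2) : Mor C).
Proof.
split=> [g|f] c u v; congr pair.
- by rewrite /= linearPl.
- rewrite /= (linearPl (ai10 a)) linearD linearZ /= !linearDl !linearZl_LR.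
  by rewrite !scalerDr; zmod.
- by rewrite /= linearPr.
- by rewrite /= !linearPr scalerDr; zmod.
Qed.

Definition cx_mul := pack_bilinear cx_mul_bilinear.

(** Functoriality is where the axiom [ai_A3] is needed: the two sides of the
    interchange law differ by [δ g ⊙ f' - g ⊙ δ f']. *)
Definition bilin_functor_of : bilin_functor C.
Proof.
refine (@BilinFunctor k C (ai00 a) cx_mul _ _ _ _).
- by [].
- abstract (by move=> [x h] [y l] /=;
    rewrite linearD /= ai_A1 ai_A2 linearDr !linearDl /=; zmod).
- abstract (by move=> x y; congr pair; rewrite /= linear0l linear0r addr0).
- abstract (move=> [_ g] [x f] [_ g'] [y f'] /= -> -> e; congr pair;
    rewrite /= (linearD delta); bil (ai10 a); bil (ai01 a); zlin (ai_A3 g f')).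
Defined.

Lemma cx_snd_hbul x x' y y' (f : @hom _ C x x') (g : @hom _ C y y') :
  (hmor (hbul bilin_functor_of f g)).2 = (hmor f).2 ⊙l y + x' ⊙r (hmor g).2.
Proof. by case: f g => [f sf tf] [g sg tg]; rewrite /= -tf -sg. Qed.

Definition cx_sndE :=
  (cx_snd_hcomp, cx_snd_hadd, cx_snd_hretarget, cx_snd_hid, cx_snd_hbul).

Definition cx_asc (x y z : Ob C) : @hom _ C (x ⊙ y ⊙ z) (x ⊙ (y ⊙ z)) :=
  cx_hom (esym (ai_A4 x y z)).

Lemma cx_asc_trilinear : trilinear_map (fun x y z => hmor (cx_asc x y z)).
Proof.
have [e1 e2 e3] := mu_trilinear a.
split=> x y c u v; congr pair; rewrite /= ?(e1, e2, e3) //.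
- by rewrite !linearPl.
- by rewrite linearPr linearPl.
- by rewrite !linearPr.
Qed.

(** [mu x' y' z' - mu x y z] telescopes into three differences, each changing a
    single argument by the boundary of an arrow; these are the values of [mu] in
    [ai_A5], [ai_A6] and [ai_A7]. *)
Lemma cx_asc_natural x x' y y' z z'
    (f : @hom _ C x x') (g : @hom _ C y y') (h : @hom _ C z z') :
  cx_asc x' y' z' ∘ hbul bilin_functor_of (hbul bilin_functor_of f g) h =
  hbul bilin_functor_of f (hbul bilin_functor_of g h) ∘ cx_asc x y z.
Proof.
apply: cx_homP; rewrite !cx_sndE /= linearDl linearDr /=.
have e1 := ai_A7 (hmor f).2 y z; have e2 := ai_A6 x' (hmor g).2 z.
have e3 := ai_A5 x' y' (hmor h).2.
rewrite cx_boundary trilinear_subl in e1; last exact: mu_trilinear.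
rewrite cx_boundary trilinear_subm in e2; last exact: mu_trilinear.
rewrite cx_boundary trilinear_subr in e3; last exact: mu_trilinear.
zlin (esym (congr2 +%R e1 (congr2 +%R e2 e3))).
Qed.

Lemma cx_asc_coherence x y z t :
  hbul bilin_functor_of (hid x) (cx_asc y z t) ∘ cx_asc x (y ⊙ z) t ∘
    hbul bilin_functor_of (cx_asc x y z) (hid t) =
  cx_asc x y (z ⊙ t) ∘ cx_asc (x ⊙ y) z t.
Proof.
apply: cx_homP; rewrite !cx_sndE /= linear0l linear0r add0r addr0.
have e := ai_A8 x y z t.
zlin e.
Qed.

Definition assoc2_of : assoc2 k :=
  @Assoc2 k C bilin_functor_of cx_asc cx_asc_trilinear
    (fun x y z => hom_is_iso _) cx_asc_natural cx_asc_coherence.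

End Assoc2OfAinf.

Section ChainMap.
Variables (k : fieldType) (U1 U0 V1 V0 : lmodType k).
Variables (d : {linear U1 -> U0}) (e : {linear V1 -> V0}).
Variables (f0 : {linear U0 -> V0}) (f1 : {linear U1 -> V1}).
Hypothesis f_chain : forall h, f0 (d h) = e (f1 h).

Let M := Mor (two_vect_of d).
Let N := Mor (two_vect_of e).

Lemma cx_map_linear : linear (fun p : M => (f0 p.1, f1 p.2) : N).
Proof. by move=> c p q; congr pair; rewrite linearP. Qed.

Definition lin_functor_of : lin_functor (two_vect_of d) (two_vect_of e).
Proof.
refine (@LinFunctor k (two_vect_of d) (two_vect_of e) f0 (pack_linear cx_map_linear)
  _ _ _ _) => //=.
- abstract (by move=> p; rewrite linearD /= f_chain).
- abstract (by move=> x; rewrite linear0).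
- abstract (by move=> p q e1 e2; rewrite /cx_comp /= linearD).
Defined.

Lemma cx_snd_hmap x y (p : @hom _ (two_vect_of d) x y) :
  (hmor (hmap lin_functor_of p)).2 = f1 (hmor p).2.
Proof. by []. Qed.

End ChainMap.

Section Diff2OfDiffAinf.
Variables (k : fieldType) (a : diff_ainf k).
Let C := assoc2_of a.
Let D : lin_functor C C := lin_functor_of (@d_delta _ _ (da_op a)).

Definition cx_do2 (x y : Ob C) :
    hom (D (x • y)) (D x • y + x • D y + D x • D y) :=
  cx_hom (esym (d_D1 (da_op a) x y)).

Lemma cx_do2_bilinear : bilinear_map (fun x y => hmor (cx_do2 x y)).
Proof.
split=> [y|x] c u v; congr pair; rewrite /= ?linearPl ?linearPr //.
  by rewrite linearP.
by rewrite linearP.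
Qed.

(** As for the associator, [d2 x' y' - d2 x y] telescopes into one term for [d_D2]
    and one for [d_D3]. *)
Lemma cx_do2_natural x x' y y' (f : @hom _ C x x') (g : @hom _ C y y') :
  cx_do2 x' y' ∘ hmap D (f ⊡ g) =
  (hmap D f ⊡ g ⊞ f ⊡ hmap D g ⊞ hmap D f ⊡ hmap D g) ∘ cx_do2 x y.
Proof.
apply: cx_homP; rewrite !(cx_sndE, cx_snd_hmap) /=.
rewrite (linearD (d1 (da_op a))).
have e1 := d_D3 (da_op a) (hmor f).2 y; have e2 := d_D2 (da_op a) x' (hmor g).2.
rewrite cx_boundary linearBl in e1; rewrite cx_boundary linearBr in e2.
zlin (esym (congr2 +%R e1 e2)).
Qed.

Lemma cx_do2_coherence (x y z : Ob C) :
  (asc (D x) y z ⊞ asc x (D y) z ⊞ asc (D x) (D y) z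
     ⊞ asc x y (D z) ⊞ asc (D x) y (D z)
     ⊞ asc x (D y) (D z) ⊞ asc (D x) (D y) (D z))
    ∘ hretarget (bul_expand D x y z)
        (cx_do2 x y ⊡ hid z ⊞ hid (x • y • D z) ⊞ cx_do2 x y ⊡ hid (D z))
    ∘ cx_do2 (x • y) z
  = (hid (D x • (y • z)) ⊞ hid x ⊡ cx_do2 y z ⊞ hid (D x) ⊡ cx_do2 y z)
      ∘ cx_do2 x (y • z) ∘ hmap D (asc x y z) :> Mor C.
Proof.
(* The targets of the sides are only provably equal, so that the sides are
   compared componentwise; the first components agree by computation. *)
apply: injective_projections; first by [].
rewrite 4!cx_snd_hcomp cx_snd_hretarget !cx_sndE /=.
rewrite !(linear0l, linear0r) !add0r !addr0.
have e := d_D4 (da_op a) x y z; rewrite linearDl linearDr /= in e.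
zlin (esym e).
Qed.

Definition diff_op_of : diff_op C :=
  @DiffOp k C D cx_do2 cx_do2_bilinear (fun x y => hom_is_iso _)
    cx_do2_natural cx_do2_coherence.

Definition diff2_of : diff2 k := Diff2 diff_op_of.

End Diff2OfDiffAinf.

Section Diff2HomOfDiffAinfHom.
Variables (k : fieldType) (a a' : diff_ainf k) (f : diff_ainf_hom a a').
Let C := diff2_of a.
Let C' := diff2_of a'.
Let F : lin_functor C C' := lin_functor_of (@phi_delta _ _ _ f).
Let D := df_op C.
Let D' := df_op C'.

Definition cx_ah2 (x y : Ob C) : hom (F x • F y) (F (x • y)) :=
  cx_hom (esym (phi2_00 f x y)).

Lemma cx_ah2_bilinear : bilinear_map (fun x y => hmor (cx_ah2 x y)).
Proof.
by split=> [y|x] c u v; congr pair; rewrite /= ?(linearP f) ?linearPl ?linearPr.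
Qed.

Lemma cx_ah2_natural x x' y y' (p : @hom _ C x x') (q : @hom _ C y y') :
  cx_ah2 x' y' ∘ (hmap F p ⊡ hmap F q) = hmap F (p ⊡ q) ∘ cx_ah2 x y.
Proof.
apply: cx_homP; rewrite !(cx_sndE, cx_snd_hmap) /=.
rewrite (linearD (phi1 f)).
have e1 := phi2_10 f (hmor p).2 y; have e2 := phi2_01 f x' (hmor q).2.
rewrite cx_boundary linearBl in e1; rewrite cx_boundary linearBr in e2.
zlin (esym (congr2 +%R e1 e2)).
Qed.

Lemma cx_ah2_coherence (x y z : Ob C) :
  cx_ah2 x (y • z) ∘ (hid (F x) ⊡ cx_ah2 y z) ∘ asc (F x) (F y) (F z) =
  hmap F (asc x y z) ∘ cx_ah2 (x • y) z ∘ (cx_ah2 x y ⊡ hid (F z)).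
Proof.
apply: cx_homP; rewrite !cx_sndE /= !(linear0l, linear0r) !add0r !addr0.
have e := phi2_mu f x y z.
zlin (esym e).
Qed.

Definition assoc2_hom_of : assoc2_hom C C' :=
  @Assoc2Hom k C C' F cx_ah2 cx_ah2_bilinear (fun x y => hom_is_iso _)
    cx_ah2_natural cx_ah2_coherence.

Definition cx_dh3 (x : Ob C) : hom (D' (F x)) (F (D x)) :=
  cx_hom (esym (phi3_d0 f x)).

Lemma cx_dh3_linear : linear (fun x => hmor (cx_dh3 x)).
Proof. by move=> c u v; congr pair; rewrite /= !linearP. Qed.

Lemma cx_dh3_natural x x' (p : @hom _ C x x') :
  cx_dh3 x' ∘ hmap D' (hmap F p) = hmap F (hmap D p) ∘ cx_dh3 x.
Proof.
apply: cx_homP; rewrite !cx_sndE !cx_snd_hmap /=.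
have e := phi3_d1 f (hmor p).2; rewrite cx_boundary linearB in e.
zlin (esym e).
Qed.

Lemma cx_dh3_coherence (x y : Ob C) :
  hmap F (do2 D x y) ∘ cx_dh3 (x • y) ∘ hmap D' (cx_ah2 x y)
  = (cx_ah2 (D x) y ⊞ cx_ah2 x (D y) ⊞ cx_ah2 (D x) (D y))
      ∘ (cx_dh3 x ⊡ hid (F y) ⊞ hid (F x) ⊡ cx_dh3 y ⊞ cx_dh3 x ⊡ cx_dh3 y)
      ∘ do2 D' (F x) (F y) :> Mor C'.
Proof.
apply: injective_projections; first by [].
rewrite !cx_sndE /= !(linear0l, linear0r) !add0r !addr0.
have e := phi3_d2 f x y.
zlin e.
Qed.

Definition diff2_hom_of : diff2_hom C C' :=
  @Diff2Hom k C C' assoc2_hom_of cx_dh3 cx_dh3_linear (fun x => hom_is_iso _)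
    cx_dh3_natural cx_dh3_coherence.

End Diff2HomOfDiffAinfHom.

Lemma diff2_hom_of_id (k : fieldType) (a : diff_ainf k) :
  diff2_hom_of (diff_ainf_id a) = diff2_id (diff2_of a).
Proof. by apply: diff2_hom_ext => [||//|//]; apply: linear_ext => // -[]. Qed.

Lemma diff2_hom_of_comp (k : fieldType) (a a' a'' : diff_ainf k)
    (g : diff_ainf_hom a' a'') (f : diff_ainf_hom a a') :
  diff2_hom_of (diff_ainf_comp g f) = diff2_comp (diff2_hom_of g) (diff2_hom_of f).
Proof.
apply: diff2_hom_ext => [||x y|x].
- exact: linear_ext.
- exact: linear_ext.
- by congr pair; rewrite addrC.
- by congr pair; rewrite addrC.
Qed.

Definition diff2_functor (k : fieldType) :
    functor (TwoTermDiffAinf k) (DiffAss2 k) :=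
  @Functor (TwoTermDiffAinf k) (DiffAss2 k) (@diff2_of k)
    (@diff2_hom_of k) (@diff2_hom_of_id k)
    (fun C C' C'' G F => diff2_hom_of_comp G F).

(** * Strict homomorphisms *)

Section StrictAinf.
Variable k : fieldType.

(** Such a map is a homomorphism with zero homotopies, and if it is bijective its
    inverse is another one; both natural isomorphisms of the equivalence have
    strict maps as components. *)
Record strict_ainf_map (a a' : diff_ainf k) := StrictAinfMap {
  sa0 : {linear A0 a -> A0 a'};
  sa1 : {linear A1 a -> A1 a'};
  sa_delta : forall h, sa0 (delta h) = delta (sa1 h);
  sa_00 : forall x y, sa0 (x ⊙ y) = sa0 x ⊙ sa0 y;
  sa_01 : forall x h, sa1 (x ⊙r h) = sa0 x ⊙r sa1 h;
  sa_10 : forall h x, sa1 (h ⊙l x) = sa1 h ⊙l sa0 x;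
  sa_mu : forall x y z, sa1 (mu x y z) = mu (sa0 x) (sa0 y) (sa0 z);
  sa_d0 : forall x, sa0 (da_op a x) = da_op a' (sa0 x);
  sa_d1 : forall h, sa1 (d1 (da_op a) h) = d1 (da_op a') (sa1 h);
  sa_d2 : forall x y, sa1 (d2 (da_op a) x y) = d2 (da_op a') (sa0 x) (sa0 y) }.

Definition strict_ainf_hom_alg (a a' : diff_ainf k) (f : strict_ainf_map a a') :
  ainf_hom a a'.
Proof.
refine (@AinfHom k a a' (sa0 f) (sa1 f) (pack_bilinear (@zero_bilinear k _ _ _))
  (sa_delta f) _ _ _ _).
- abstract (by move=> x y; rewrite sa_00 subrr linear0).
- abstract (by move=> x h; rewrite sa_01 subrr).
- abstract (by move=> h x; rewrite sa_10 subrr).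
- abstract (by move=> x y z; rewrite sa_mu linear0l linear0r !subrr addr0 subr0).
Defined.

Definition strict_ainf_hom (a a' : diff_ainf k) (f : strict_ainf_map a a') :
  diff_ainf_hom a a'.
Proof.
refine (@DiffAinfHom k a a' (strict_ainf_hom_alg f) (pack_linear (@zero_linear k _ _))
  _ _ _) => /=.
- abstract (by move=> x; rewrite sa_d0 subrr linear0).
- abstract (by move=> h; rewrite sa_d1 subrr).
- abstract (by move=> x y; rewrite sa_d2 !(linear0l (ai10 a')) !(linear0r (ai01 a'))
    (linear0 (d1 (da_op a'))); zmod).
Defined.

Definition strict_ainf_inv (a a' : diff_ainf k) (f : strict_ainf_map a a')
    (g0 : {linear A0 a' -> A0 a}) (g1 : {linear A1 a' -> A1 a})
    (fg0 : cancel g0 (sa0 f)) (gf0 : cancel (sa0 f) g0)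
    (fg1 : cancel g1 (sa1 f)) (gf1 : cancel (sa1 f) g1) : strict_ainf_map a' a.
Proof.
refine (@StrictAinfMap a' a g0 g1 _ _ _ _ _ _ _ _); abstract (by move=> *;
  first [apply: (can_inj gf0) | apply: (can_inj gf1)];
  rewrite ?(sa_delta, sa_00, sa_01, sa_10, sa_mu, sa_d0, sa_d1, sa_d2) ?(fg0, fg1)).
Defined.

End StrictAinf.

Section StrictDiff2.
Variable k : fieldType.

(** Equalities are imposed on morphisms; on objects they follow by taking
    sources. *)
Record strict_diff2_map (C C' : diff2 k) := StrictDiff2Map {
  sd :> lin_functor C C';
  sd_bul : forall f g,
    lf_mor sd (bf_mor (bul C) f g) = bf_mor (bul C') (lf_mor sd f) (lf_mor sd g);
  sd_asc : forall x y z,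
    lf_mor sd (hmor (asc x y z)) = hmor (asc (sd x) (sd y) (sd z));
  sd_D : forall f,
    lf_mor sd (lf_mor (df_op C) f) = lf_mor (df_op C') (lf_mor sd f);
  sd_do2 : forall x y,
    lf_mor sd (hmor (do2 (df_op C) x y)) = hmor (do2 (df_op C') (sd x) (sd y)) }.

Lemma sd_bul_ob (C C' : diff2 k) (F : strict_diff2_map C C') x y :
  F (x • y) = F x • F y.
Proof.
have := congr1 src (sd_bul F (idt C x) (idt C y)).
by rewrite lf_src !bf_src !lf_src !src_idt.
Qed.

Lemma sd_D_ob (C C' : diff2 k) (F : strict_diff2_map C C') x :
  F (df_op C x) = df_op C' (F x).
Proof.
have := congr1 src (sd_D F (idt C x)).
by rewrite !lf_src !src_idt.
Qed.

Section StrictHom.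
Variables (C C' : diff2 k) (F : strict_diff2_map C C').

(** The identity of [F x • F y], whose target has to be rewritten because
    [F (x • y)] is equal, but not convertible, to its source. *)
Definition strict_ah2 (x y : Ob C) : hom (F x • F y) (F (x • y)) :=
  hretarget (esym (sd_bul_ob F x y)) (hid _).

Lemma strict_ah2_bilinear : bilinear_map (fun x y => hmor (strict_ah2 x y)).
Proof.
split=> [y|x] c u v /=; rewrite linearP.
  by rewrite linearPl linearP.
by rewrite linearPr linearP.
Qed.

Lemma strict_ah2_natural x x' y y' (f : hom x x') (g : hom y y') :
  strict_ah2 x' y' ∘ (hmap F f ⊡ hmap F g) = hmap F (f ⊡ g) ∘ strict_ah2 x y.
Proof.
apply: hom_ext; rewrite !hcompE /= sd_bul sd_bul_ob; zmod.
Qed.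

Lemma strict_ah2_coherence x y z :
  strict_ah2 x (y • z) ∘ (1h ⊡ strict_ah2 y z) ∘ asc (F x) (F y) (F z) =
  hmap F (asc x y z) ∘ strict_ah2 (x • y) z ∘ (strict_ah2 x y ⊡ 1h).
Proof.
apply: hom_ext; rewrite !hcompE /= sd_asc !bf_idt !sd_bul_ob; zmod.
Qed.

Definition strict_assoc2_hom : assoc2_hom C C' :=
  Assoc2Hom strict_ah2_bilinear (fun x y => hom_is_iso _)
    strict_ah2_natural strict_ah2_coherence.

Definition strict_dh3 (x : Ob C) : hom (df_op C' (F x)) (F (df_op C x)) :=
  hretarget (esym (sd_D_ob F x)) (hid _).

Lemma strict_dh3_linear : linear (fun x => hmor (strict_dh3 x)).
Proof. by move=> c u v; rewrite /= !linearP. Qed.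

Lemma strict_dh3_natural x x' (f : hom x x') :
  strict_dh3 x' ∘ hmap (df_op C') (hmap F f) =
  hmap F (hmap (df_op C) f) ∘ strict_dh3 x.
Proof.
apply: hom_ext; rewrite !hcompE /= sd_D sd_D_ob; zmod.
Qed.

Lemma strict_dh3_coherence x y :
  hmap F (do2 (df_op C) x y) ∘ strict_dh3 (x • y)
    ∘ hmap (df_op C') (strict_ah2 x y)
  = (strict_ah2 (df_op C x) y ⊞ strict_ah2 x (df_op C y)
       ⊞ strict_ah2 (df_op C x) (df_op C y))
      ∘ (strict_dh3 x ⊡ hid (F y) ⊞ hid (F x) ⊡ strict_dh3 y
           ⊞ strict_dh3 x ⊡ strict_dh3 y)
      ∘ do2 (df_op C') (F x) (F y) :> Mor C'.
Proof.
rewrite !hcompE /= sd_do2 !bf_idt lf_idt !(sd_bul_ob, sd_D_ob, idtD); zmod.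
Qed.

Definition strict_diff2_hom : diff2_hom C C' :=
  @Diff2Hom k C C' strict_assoc2_hom strict_dh3 strict_dh3_linear
    (fun x => hom_is_iso _) strict_dh3_natural strict_dh3_coherence.

End StrictHom.

Section StrictInverse.
Variables (C C' : diff2 k) (F : strict_diff2_map C C').
Variables (G0 : {linear Ob C' -> Ob C}) (G1 : {linear Mor C' -> Mor C}).
Hypotheses (FG0 : cancel G0 F) (GF0 : cancel F G0).
Hypotheses (FG1 : cancel G1 (lf_mor F)) (GF1 : cancel (lf_mor F) G1).

Lemma lin_functor_inv_comp g f e e' :
  G1 (comp g f e) = comp (G1 g) (G1 f) e'.
Proof.
apply: (can_inj GF1); rewrite FG1.
have e'' : src (lf_mor F (G1 g)) = tgt (lf_mor F (G1 f)) by rewrite !FG1.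
by rewrite (lf_comp e' e''); apply: comp_eq; rewrite FG1.
Qed.

Definition lin_functor_inv : lin_functor C' C.
Proof.
refine (@LinFunctor k C' C G0 G1 _ _ _ _).
- abstract (by move=> f; apply: (can_inj GF0); rewrite FG0 -lf_src FG1).
- abstract (by move=> f; apply: (can_inj GF0); rewrite FG0 -lf_tgt FG1).
- abstract (by move=> x; apply: (can_inj GF1); rewrite FG1 lf_idt FG0).
- exact: lin_functor_inv_comp.
Defined.

Definition strict_diff2_inv : strict_diff2_map C' C.
Proof.
refine (@StrictDiff2Map C' C lin_functor_inv _ _ _ _).
- abstract (by move=> f g; apply: (can_inj GF1); rewrite sd_bul !FG1).
- abstract (by move=> x y z; apply: (can_inj GF1); rewrite sd_asc FG1 /= !FG0).
- abstract (by move=> f; apply: (can_inj GF1); rewrite sd_D !FG1).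
- abstract (by move=> x y; apply: (can_inj GF1); rewrite sd_do2 FG1 /= !FG0).
Defined.

End StrictInverse.
End StrictDiff2.

(** * The two natural isomorphisms *)

Definition nat_iso_sym (C D : category) (F G : functor C D) (e : nat_iso F G) :
  nat_iso G F.
Proof.
refine (@NatIso C D G F (ni_inv e) (ni_arr e) _ (ni_invr e) (ni_invl e)).
abstract (move=> x y f; rewrite -[LHS](compose_idr) -(ni_invr e x) compose_assoc
  -(compose_assoc _ (farr G f)) -(ni_natural e f) compose_assoc (ni_invl e)
  compose_idl; done).
Defined.

Section KernelOfComplex.
Variables (k : fieldType) (a : diff_ainf k).
Let C := diff2_of a.

Definition kernel_proj : {linear ker C -> A1 a} :=
  [the {linear _ -> _} of snd \o @kval _ _ _ _].

Lemma kernel_projE (f : Mor C) : kernel_proj (arrow_part f) = f.2.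
Proof. by rewrite /= subr0. Qed.

Lemma kernel_inj_linear : linear (fun h : A1 a => @arrow_part k C (0, h)).
Proof.
move=> c h l; have -> : (0, c *: h + l) = c *: (0, h) + (0, l) :> Mor C.
  by congr pair; rewrite /= scaler0 addr0.
exact: linearP.
Qed.

Definition kernel_inj := pack_linear kernel_inj_linear.

Lemma kernel_projK : cancel kernel_proj kernel_inj.
Proof.
move=> h; rewrite -[RHS]arrow_partK; congr (arrow_part _).
by apply: injective_projections => //=; rewrite -[LHS](kval0 h).
Qed.

Lemma kernel_injK : cancel kernel_inj kernel_proj.
Proof. by move=> h; apply: kernel_projE. Qed.

(** The arrows out of [0] in the category of a complex are the pairs [(0, h)],
    so that its kernel complex is the original one. *)
Definition kernel_proj_strict : strict_ainf_map (diff_ainf_of C) a.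
Proof.
refine (@StrictAinfMap k (diff_ainf_of C) a [the {linear _ -> _} of idfun] kernel_proj
  _ _ _ _ _ _ _ _).
- abstract (by move=> h; have e := kval0 h; rewrite /= in e; rewrite /= e add0r).
- by [].
- abstract (by move=> x h; rewrite [LHS]kernel_projE /= linear0l add0r linear0 addr0).
- abstract (by move=> h x; rewrite [LHS]kernel_projE /= linear0r addr0).
- abstract (by move=> x y z; exact: kernel_projE).
- by [].
- abstract (by move=> h; exact: kernel_projE).
- abstract (by move=> x y; exact: kernel_projE).
Defined.

Let idfunK : cancel (idfun : A0 a -> A0 a) idfun. Proof. by []. Qed.

Definition kernel_inj_strict : strict_ainf_map a (diff_ainf_of C) :=
  @strict_ainf_inv k _ _ kernel_proj_strict [the {linear _ -> _} of idfun] kernel_inj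
    idfunK idfunK kernel_injK kernel_projK.

End KernelOfComplex.

Section SplitMorphisms.
Variables (k : fieldType) (C : diff2 k).
Let C' := diff2_of (diff_ainf_of C).

Lemma split_linear : linear (fun f : Mor C => (src f, arrow_part f) : Mor C').
Proof. by move=> c f g; congr pair; rewrite linearP. Qed.

Definition split_mor := pack_linear split_linear.

Lemma glue_linear : linear (fun p : Mor C' => idt C p.1 + kval p.2 : Mor C).
Proof. by move=> c p q; rewrite /= !linearP scalerDr; zmod. Qed.

Definition glue_mor := pack_linear glue_linear.

Lemma splitK : cancel split_mor glue_mor.
Proof. by move=> f; rewrite /= addrC subrK. Qed.

Lemma glueK : cancel glue_mor split_mor.
Proof.
move=> [x h]; congr pair; rewrite /= linearD /=.
  by rewrite src_idt kval0 addr0.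
by rewrite arrow_part_idt arrow_partK add0r.
Qed.

Lemma tgt_split (f : Mor C) : src f + tgt (kval (arrow_part f)) = tgt f.
Proof. by rewrite (tgt_arrow_part (mor_hom f)) addrC subrK. Qed.

Definition split_functor : lin_functor C C'.
Proof.
refine (@LinFunctor k C C' [the {linear _ -> _} of idfun] split_mor _ _ _ _).
- by [].
- abstract (by move=> f; exact: tgt_split).
- abstract (by move=> x; congr pair; [exact: src_idt | exact: arrow_part_idt]).
- abstract (move=> g f e e'; congr pair; first exact: src_comp;
    by rewrite /= comp_add -e linearB linearD /= arrow_part_idt subr0).
Defined.

(** Every arrow is the sum of an identity and of an arrow out of [0]; that
    splitting respects the operations is the content of the rules for arrow
    parts, applied to an arrow seen as a morphism between its own ends. *)
Definition split_strict : strict_diff2_map C C'.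
Proof.
refine (@StrictDiff2Map k C C' split_functor _ _ _ _).
- abstract (move=> f g; congr pair; first exact: bf_src;
   by rewrite [LHS](arrow_part_hbul (bul C) (mor_hom f) (mor_hom g)) /= tgt_split).
- abstract (by move=> x y z; congr pair; exact: hsrc).
- abstract (move=> f; congr pair; first exact: lf_src;
   by rewrite [LHS](arrow_part_hmap _ (mor_hom f))).
- abstract (by move=> x y; congr pair; exact: hsrc).
Defined.

Let idfunK : cancel (idfun : Ob C -> Ob C) idfun. Proof. by []. Qed.

Definition glue_strict : strict_diff2_map C' C :=
  @strict_diff2_inv k C C' split_strict [the {linear _ -> _} of idfun] glue_mor
    idfunK idfunK glueK splitK.

End SplitMorphisms.

(** The strict maps have zero homotopies, so that both ways around a naturality
    square at [f] have the homotopies of [f]. *)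
Definition kernel_proj_iso (k : fieldType) :
  nat_iso (functor_comp (diff_ainf_functor k) (diff2_functor k))
          (functor_id (TwoTermDiffAinf k)).
Proof.
refine (@NatIso (TwoTermDiffAinf k) (TwoTermDiffAinf k)
  (functor_comp (diff_ainf_functor k) (diff2_functor k)) (functor_id _)
  (fun a => strict_ainf_hom (kernel_proj_strict a))
  (fun a => strict_ainf_hom (kernel_inj_strict a)) _ _ _).
- move=> a a' f; apply: diff_ainf_hom_ext => [//|h|x y|x].
  + exact: kernel_projE.
  + by rewrite /= subr0 linear0 addrC.
  + by rewrite /= subr0 linear0 addrC.
- move=> a; apply: diff_ainf_hom_ext => [//|h|x y|x].
  + exact: kernel_projK.
  + by rewrite /= linear0 addr0.
  + by rewrite /= linear0 addr0.
- move=> a; apply: diff_ainf_hom_ext => [//|h|x y|x].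
  + exact: kernel_injK.
  + by rewrite /= addr0.
  + by rewrite /= addr0.
Defined.

Definition split_iso (k : fieldType) :
  nat_iso (functor_id (DiffAss2 k))
    (functor_comp (diff2_functor k) (diff_ainf_functor k)).
Proof.
refine (@NatIso (DiffAss2 k) (DiffAss2 k) (functor_id _)
  (functor_comp (diff2_functor k) (diff_ainf_functor k))
  (fun C => strict_diff2_hom (split_strict C))
  (fun C => strict_diff2_hom (glue_strict C)) _ _ _).
- move=> C C' F; apply: diff2_hom_ext => [||x y|x].
  + exact: linear_ext.
  + apply: linear_ext => f; congr pair; first exact: lf_src.
    exact: (arrow_part_hmap F (mor_hom f)).
  + by rewrite /= /cx_comp; congr pair; rewrite /= !linear0 add0r addr0.
  + by rewrite /= /cx_comp; congr pair; rewrite /= !linear0 add0r addr0.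
- move=> C; apply: diff2_hom_ext => [||x y|x].
  + exact: linear_ext.
  + apply: linear_ext; exact: splitK.
  + by rewrite /= comp_add tgt_idt addr0 addrK.
  + by rewrite /= comp_add tgt_idt addr0 addrK.
- move=> C; apply: diff2_hom_ext => [||x y|x].
  + exact: linear_ext.
  + apply: linear_ext; exact: glueK.
  + by rewrite /= /cx_comp; congr pair; rewrite /= arrow_part_idt addr0.
  + by rewrite /= /cx_comp; congr pair; rewrite /= arrow_part_idt addr0.
Defined.

Theorem theorem4p10 (k : fieldType) (k_char0 : [pchar k] =i pred0) :
  equivalent (DiffAss2 k) (TwoTermDiffAinf k).
Proof.
exists (diff_ainf_functor k), (diff2_functor k); split; constructor.
  exact: (nat_iso_sym (split_iso k)).
exact: kernel_proj_iso.
Qed.
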